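(* For $n\ge1$, the number of symplectic triangular elements of the Weyl group $W_{C_n}$ is given by the sequence A032351 of the OEIS, i.e. it equals the number of permutations in $S_{n+1}$ which contain neither the pattern $4231$ nor the pattern $2413$.
   Context: The Weyl group $W_{C_n}$ of $\mathfrak{sp}_{2n}(\mathbb C)$ is generated by simple reflections $s_1,\dots,s_n$ (with $s_n$ corresponding to the long simple root). Let $t_1,\dots,t_{2n-1}$ be the simple transpositions of $S_{2n}$. The map $\iota: W_{C_n}\to S_{2n}$, $s_i\mapsto t_it_{2n-i}$ for $i\le n-1$, $s_n\mapsto t_n$, identifies $W_{C_n}$ with the subgroup of all $\tau\in S_{2n}$ with $\tau=w_0\tau w_0$, where $w_0(i)=2n+1-i$. A permutation $\tau\in S_N$ contains a pattern $i_1i_2i_3i_4$ (a permutation of $1,2,3,4$ in one-line notation) if there are $j_1<j_2<j_3<j_4$ such that $(\tau(j_1),\tau(j_2),\tau(j_3),\tau(j_4))$ is in the same relative order as $(i_1,i_2,i_3,i_4)$. A permutation in $S_N$ is triangular if it contains neither $4231$ nor $2413$. An element $w\in W_{C_n}$ is symplectic triangular if $\iota(w)\in S_{2n}$ is triangular. The OEIS sequence A032351 counts the triangular elements of the symmetric groups. *)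

(* Defs.v *)
From mathcomp Require Import all_boot all_order all_fingroup all_algebra zify.

Set Implicit Arguments.
Unset Strict Implicit.
Unset Printing Implicit Defensive.

Import GroupScope GRing.Theory Num.Theory.
Local Open Scope ring_scope.

(* Permutations of {1, ..., N} are elements of 'S_N, the value k being the
   ordinal k - 1.  Patterns are written with values 1, 2, ... *)

Definition contains (N : nat) (pi : seq nat) (tau : 'S_N) : bool :=
  [exists j : {ffun 'I_(size pi) -> 'I_N},
    [forall a : 'I_(size pi), forall b : 'I_(size pi),
      ((a < b)%N ==> (j a < j b)%N)
      && ((tau (j a) < tau (j b))%N == (nth 0 pi a < nth 0 pi b)%N)]].

Definition triangular (N : nat) (tau : 'S_N) : bool :=
  ~~ contains [:: 4; 2; 3; 1]%N tau && ~~ contains [:: 2; 4; 1; 3]%N tau.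

(* The transposition exchanging k and k + 1, for 1 <= k < N (a junk value
   otherwise). *)
Definition transp (N k : nat) : 'S_N :=
  if (insub k.-1, insub k) is (Some x, Some y) then tperm x y else 1%g.

Lemma val_transp (N k : nat) (x : 'I_N) : (0 < k < N)%N ->
  transp N k x =
    (if x == k.-1 :> nat then k else if x == k :> nat then k.-1 else x) :> nat.
Proof.
case/andP=> k_gt0 lt_kN; have lt_k1N : (k.-1 < N)%N by lia.
rewrite /transp (insubT (fun m => m < N)%N lt_k1N).
rewrite (insubT (fun m => m < N)%N lt_kN) permE /= -!(inj_eq val_inj) /=.
by case: ifP => // _; case: ifP.
Qed.

Section RootSystem.

Variable n : nat.
Implicit Types (u v a : 'rV[rat]_n) (i : 'I_n).

Definition evec (m : nat) : 'rV[rat]_n := \row_(j < n) (j == m :> nat)%:R.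

Definition dot u v : rat := (u *m v^T) 0 0.

Definition refl a v : 'rV[rat]_n := v - (2 * dot v a / dot a a) *: a.

(* The roots +-e_i +- e_j (i != j) and +-2e_i of sp_2n; the terms with i = j
   give +-2e_i or 0. *)
Definition C_roots : seq 'rV[rat]_n :=
  [seq v <- [seq (-1) ^+ x.2 *: evec x.1 + (-1) ^+ y.2 *: evec y.1
               | x : 'I_n * bool <- enum {: 'I_n * bool},
                 y : 'I_n * bool <- enum {: 'I_n * bool}]
   | v != 0].

Definition simple_root i : 'rV[rat]_n :=
  if (i.+1 < n)%N then evec i - evec i.+1 else 2 *: evec i.

Lemma dotDl u v a : dot (u + v) a = dot u a + dot v a.
Proof. by rewrite /dot mulmxDl mxE. Qed.

Lemma dotZl c u a : dot (c *: u) a = c * dot u a.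
Proof. by rewrite /dot -scalemxAl mxE. Qed.

Lemma dotC u v : dot u v = dot v u.
Proof. by rewrite /dot -[u *m _]trmxK trmx_mul trmxK mxE. Qed.

Lemma dot_e (i : 'I_n) m : dot (evec i) (evec m) = (i == m :> nat)%:R.
Proof.
rewrite /dot mxE (bigD1 i) //= big1 ?addr0.
  by rewrite !mxE eqxx mul1r.
by move=> j ji; rewrite !mxE (negPf (ji : (j != i :> nat))) mul0r.
Qed.

Lemma reflD a u v : refl a (u + v) = refl a u + refl a v.
Proof.
by rewrite /refl dotDl mulrDr mulrDl scalerDl opprD addrACA.
Qed.

Lemma reflZ a c u : refl a (c *: u) = c *: refl a u.
Proof. by rewrite /refl dotZl scalerBr scalerA mulrCA !mulrA. Qed.

Lemma dotBr a u v : dot a (u - v) = dot a u - dot a v.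
Proof. by rewrite dotC dotDl -scaleN1r dotZl mulN1r !(dotC a). Qed.

Lemma dotZr c u a : dot a (c *: u) = c * dot a u.
Proof. by rewrite dotC dotZl dotC. Qed.

Lemma dotBl a u v : dot (u - v) a = dot u a - dot v a.
Proof. by rewrite dotC dotBr !(dotC a). Qed.

Lemma refl_e (i m : 'I_n) :
  refl (simple_root i) (evec m) =
    if (i.+1 < n)%N then
      if m == i then evec i.+1 else if m == i.+1 :> nat then evec i else evec m
    else if m == i then - evec m else evec m.
Proof.
rewrite /refl /simple_root; case: ifP => [lt_in | _].
  have E := dot_e (Ordinal lt_in).
  rewrite !dotBl !dotBr !dot_e !E /= !eqxx -(inj_eq val_inj m i).
  rewrite (ltn_eqF (ltnSn i)) (gtn_eqF (ltnSn i)) subr0 sub0r opprK.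
  case: (altP (m =P i :> nat)) => [-> | ne].
    rewrite (ltn_eqF (ltnSn i)) subr0 mulr1 divff // scale1r.
    by rewrite opprB addrC subrK.
  case: (altP (m =P i.+1 :> nat)) => [-> | ne'].
    by rewrite sub0r mulrN1 mulNr divff // scaleN1r opprK addrC subrK.
  by rewrite subr0 mulr0 mul0r scale0r subr0.
rewrite !dotZr !dotZl !dot_e eqxx -(inj_eq val_inj m i).
case: (altP (m =P i :> nat)) => [-> | ne].
  rewrite !mulr1 divff // scale1r.
  by rewrite [2 *: _]scaler_nat mulr2n opprD addrA subrr sub0r.
by rewrite !mulr0 mul0r scale0r subr0.
Qed.

Lemma reflK i : involutive (refl (simple_root i)).
Proof.
move=> v; set a := simple_root i.
have [a0|a0] := eqVneq (dot a a) 0.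
  by rewrite /refl a0 invr0 !mulr0 !scale0r !subr0.
rewrite {1}/refl {2}/refl dotBl dotZl divfK // /refl.
rewrite [2 * dot v a]mulr_natl mulr2n opprD addrA subrr sub0r.
by rewrite mulrN mulr_natl mulr2n mulNr scaleNr opprK subrK.
Qed.

Lemma mem_roots (x y : 'I_n * bool) :
  ((-1) ^+ x.2 *: evec x.1 + (-1) ^+ y.2 *: evec y.1 \in C_roots) =
  ((-1) ^+ x.2 *: evec x.1 + (-1) ^+ y.2 *: evec y.1 != 0).
Proof.
rewrite mem_filter; case: eqP => //= _.
by apply/allpairsP; exists (x, y); rewrite !mem_enum.
Qed.

Lemma refl_signed i (x : 'I_n * bool) :
  exists y : 'I_n * bool,
    refl (simple_root i) ((-1) ^+ x.2 *: evec x.1) = (-1) ^+ y.2 *: evec y.1.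
Proof.
case: x => m b /=; rewrite reflZ refl_e; case: ifP => [lt_in | _].
  case: ifP => _; first by exists (Ordinal lt_in, b).
  by case: ifP => _; [exists (i, b) | exists (m, b)].
case: ifP => _; last by exists (m, b).
by exists (m, ~~ b); rewrite /= signrN scaleNr scalerN.
Qed.

Lemma refl_roots i v : v \in C_roots -> refl (simple_root i) v \in C_roots.
Proof.
rewrite mem_filter => /andP[v0 /allpairsP[[x y] [_ _ Dv]]].
have: refl (simple_root i) v != 0.
  apply: contraNneq v0 => r0; rewrite -[v](reflK i) r0.
  by have := reflZ (simple_root i) 0 0; rewrite !scale0r => ->.
rewrite {}Dv /= reflD.
have [x' ->] := refl_signed i x; have [y' ->] := refl_signed i y.
by rewrite mem_roots.
Qed.

Definition C_root : finType := seq_sub C_roots.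

Definition refl_root i (r : C_root) : C_root := SeqSub (refl_roots i (valP r)).

Lemma refl_root_inj i : injective (refl_root i).
Proof.
by apply: (@inv_inj _ (refl_root i)) => r; apply: val_inj; apply: reflK.
Qed.

Definition simple_refl i : {perm C_root} := perm (@refl_root_inj i).

(* W_{C_n}, acting faithfully on the roots. *)
Definition WC : {group {perm C_root}} := <<[set simple_refl i | i : 'I_n]>>%G.

(* simple_refl i is s_(i+1): it maps to t_(i+1) t_(2n-i-1) if i + 1 < n and to
   t_n if i + 1 = n. *)
Definition iota_gen i : 'S_(2 * n) :=
  if (i.+1 < n)%N
  then (transp (2 * n) i.+1 * transp (2 * n) (2 * n - i.+1))%g
  else transp (2 * n) n.

(* The graph of the group morphism simple_refl i |-> iota_gen i; lemmas iota_s
   and iotaM below show that it is well defined. *)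
Definition iota_graph : {group {perm C_root} * 'S_(2 * n)} :=
  <<[set (simple_refl i, iota_gen i) | i : 'I_n]>>%G.

Definition iota (w : {perm C_root}) : 'S_(2 * n) :=
  odflt 1%g [pick tau | (w, tau) \in iota_graph].

(* The weights e_1, ..., e_n, -e_n, ..., -e_1. *)
Definition eps (k : 'I_(2 * n)) : 'rV[rat]_n :=
  if (k < n)%N then evec k else - evec (2 * n - k.+1).

Lemma val_iota_gen i k :
  iota_gen i k =
    (if (i.+1 < n)%N then
       if k == i :> nat then i.+1
       else if k == i.+1 :> nat then nat_of_ord i
       else if k == (2 * n - i.+2)%N :> nat then (2 * n - i.+1)%N
       else if k == (2 * n - i.+1)%N :> nat then (2 * n - i.+2)%N else k
     else if k == n.-1 :> nat then n else if k == n :> nat then n.-1 else k)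
    :> nat.
Proof.
have ltk := ltn_ord k; have lti := ltn_ord i.
rewrite /iota_gen; case: (ltnP i.+1 n) => [lt_in | le_ni]; last first.
  by rewrite val_transp; lia.
have lt_i2n : (0 < i.+1 < 2 * n)%N by lia.
rewrite permM; have := val_transp k lt_i2n; set x := transp _ _ k => Dx.
rewrite val_transp; last by lia.
move: Dx => /=; case: (nat_of_ord k =P i) => [ki | ki].
  by move=> ->; do !case: ifP => ?; lia.
case: (nat_of_ord k =P i.+1) => [ki1 | ki1] ->; first by rewrite !ifF //; lia.
by do !case: ifP => ?; lia.
Qed.

Lemma refl_eps i k : refl (simple_root i) (eps k) = eps (iota_gen i k).
Proof.
have reflN v : refl (simple_root i) (- v) = - refl (simple_root i) v.
  by rewrite -scaleN1r reflZ scaleN1r.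
have eE m : (m < n)%N -> refl (simple_root i) (evec m) =
    if (i.+1 < n)%N then
      if m == i then evec i.+1 else if m == i.+1 then evec i else evec m
    else if m == i then - evec m else evec m.
  by move=> lt_mn; have := refl_e i (Ordinal lt_mn); rewrite -(inj_eq val_inj).
have ltk := ltn_ord k; have lti := ltn_ord i.
rewrite /eps val_iota_gen.
case: (ltnP i.+1 n) => [lt_in | le_ni].
  case: (ltnP k n) => [lt_kn | le_nk].
    rewrite eE // lt_in.
    case: eqP => [ki | ki]; first by rewrite lt_in.
    case: eqP => [ki1 | ki1]; first by rewrite lti.
    do 2 (case: eqP => [|_]; first by lia).
    by rewrite lt_kn.
  rewrite reflN eE; last by lia.
  rewrite lt_in; do 2 (case: (nat_of_ord k =P _) => [|_]; first by lia).
  case: (nat_of_ord k =P _) => [-> | k1].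
    rewrite ifF; last by lia.
    rewrite ifT; last by lia.
    by rewrite ifF; [congr (- evec _) |]; lia.
  case: (nat_of_ord k =P _) => [-> | k2].
    rewrite ifT; last by lia.
    by rewrite ifF; [congr (- evec _) |]; lia.
  by rewrite !ifF //; lia.
case: (ltnP k n) => [lt_kn | le_nk].
  rewrite eE // ltnNge le_ni /=; case: eqP => [ki | ki].
    have -> : (nat_of_ord k == n.-1) = true by lia.
    by rewrite ltnn; congr (- evec _); lia.
  have /negPf -> : nat_of_ord k != n.-1 by lia.
  have /negPf -> : nat_of_ord k != n by lia.
  by rewrite lt_kn.
rewrite reflN eE; last by lia.
rewrite ltnNge le_ni /=.
have /negPf -> : k != n.-1 :> nat by lia.
case: (nat_of_ord k =P n) => [kn | kn].
  rewrite ifT; last by lia.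
  by rewrite ifT ?opprK; [congr (evec _) |]; lia.
by rewrite !ifF //; lia.
Qed.

Lemma iota_graphP w tau : (w, tau) \in iota_graph ->
  forall (k : 'I_(2 * n)) (r : C_root),
    val r = 2 *: eps k -> val (w r) = 2 *: eps (tau k).
Proof.
pose fits (x : {perm C_root} * 'S_(2 * n)) := [forall k, forall r : C_root,
  (val r == 2 *: eps k) ==> (val (x.1 r) == 2 *: eps (x.2 k))].
have fitsP (x : {perm C_root} * 'S_(2 * n)) : reflect (forall k (r : C_root),
    val r = 2 *: eps k -> val (x.1 r) = 2 *: eps (x.2 k)) (fits x).
  apply: (iffP 'forall_forallP) => [H k r /eqP rk | H k r].
    by apply/eqP/(implyP (H k r)).
  by apply/implyP=> /eqP/H ->.
have fits_group : group_set [set x | fits x].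
  apply/group_setP; split=> [|x y]; rewrite !inE.
    by apply/fitsP=> k r; rewrite !perm1.
  move=> /fitsP Hx /fitsP Hy; apply/fitsP=> k r rk.
  by rewrite !permM; apply/Hy/Hx.
suff sub : iota_graph \subset Group fits_group.
  by move=> /(subsetP sub); rewrite inE => /fitsP.
rewrite gen_subG; apply/subsetP=> _ /imsetP[i _ ->]; rewrite inE.
by apply/fitsP=> k r rk; rewrite permE /= rk reflZ refl_eps.
Qed.

Lemma eps_inj : injective eps.
Proof.
move=> k l; have ltk := ltn_ord k; have ltl := ltn_ord l.
have e1 (a b : nat) (lt_an : (a < n)%N) : evec b 0 (Ordinal lt_an) = (a == b)%:R.
  by rewrite mxE.
rewrite /eps; case: ifP => lt_kn; case: ifP => lt_ln.
- move/rowP/(_ (Ordinal lt_kn)); rewrite !e1 eqxx.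
  by case: (nat_of_ord k =P l) => // kl _; apply: val_inj.
- move/rowP/(_ (Ordinal lt_kn)); rewrite [RHS]mxE !e1 eqxx.
  by case: (_ == _) => /eqP.
- move/rowP/(_ (Ordinal lt_ln)); rewrite [LHS]mxE !e1 eqxx.
  by case: (_ == _) => /eqP.
have lt_k : (2 * n - k.+1 < n)%N by lia.
move/oppr_inj/rowP/(_ (Ordinal lt_k)); rewrite !e1 eqxx.
by case: eqP => // kl _; apply: val_inj => /=; lia.
Qed.

Lemma long_root_mem k : 2 *: eps k \in C_roots.
Proof.
have ltk := ltn_ord k.
suff [x ->] : exists x : 'I_n * bool, eps k = (-1) ^+ x.2 *: evec x.1.
  rewrite scaler_nat mulr2n mem_roots -mulr2n -scaler_nat !scaler_eq0.
  rewrite signr_eq0 /=; apply/eqP=> /rowP/(_ x.1).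
  by rewrite !mxE eqxx.
rewrite /eps; case: ifP => lt_kn; first by
  exists (Ordinal lt_kn, false); rewrite scale1r.
have lt_k : (2 * n - k.+1 < n)%N by lia.
by exists (Ordinal lt_k, true); rewrite scaleN1r.
Qed.

Lemma iota_graph_fun w tau1 tau2 :
  (w, tau1) \in iota_graph -> (w, tau2) \in iota_graph -> tau1 = tau2.
Proof.
move=> /iota_graphP H1 /iota_graphP H2; apply/permP=> k; apply: eps_inj.
pose r : C_root := SeqSub (long_root_mem k).
have := H1 k r erefl; rewrite (H2 k r erefl).
by move/(scalerI (isT : (2 : rat) != 0)).
Qed.

Lemma iota_graph_ex w : w \in WC -> exists tau, (w, tau) \in iota_graph.
Proof.
pose p1 := [morphism of fst : {perm C_root} * 'S_(2 * n) -> {perm C_root}].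
suff sub : WC \subset p1 @* iota_graph.
  by move=> /(subsetP sub)/morphimP[[u tau] _ gr /= ->]; exists tau.
rewrite gen_subG; apply/subsetP=> _ /imsetP[i _ ->].
apply/morphimP; exists (simple_refl i, iota_gen i) => //.
by apply/mem_gen/imset_f.
Qed.

Lemma iotaP w tau : (w, tau) \in iota_graph -> iota w = tau.
Proof.
rewrite /iota => gr; case: pickP => [tau' gr' | /(_ tau)]; last by rewrite gr.
exact: iota_graph_fun gr' gr.
Qed.

Lemma iota_s i : iota (simple_refl i) = iota_gen i.
Proof. by apply/iotaP/mem_gen/imset_f. Qed.

Lemma iotaM : {in WC &, {morph iota : u v / (u * v)%g}}.
Proof.
move=> u v /iota_graph_ex[tau gu] /iota_graph_ex[sigma gv].
by rewrite (iotaP gu) (iotaP gv); apply/iotaP/(groupM gu gv).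
Qed.

Canonical iota_morphism := Morphism iotaM.

Definition symplectic_triangular (w : {perm C_root}) : bool :=
  triangular (iota w).

End RootSystem.

(* Main.v *)
Require Import Defs.
From mathcomp Require Import all_boot all_order all_fingroup all_algebra.
From mathcomp Require Import zify.

(* List the positions of the values of a permutation: the patterns 4231 and 2413
   become 4231 and 3142, and adding a last letter to the permutation becomes
   inserting a new maximum in the list.  So the triangular permutations form a
   generating tree, in which the children of a list are given by its active
   sites, the places where a new maximum may be inserted.  In the same way, the
   list of a permutation fixed by conjugation by w_0 is the symmetrization of
   its right half, a signed permutation, which grows by inserting +M or -M,
   where M is a new maximum.

   In both trees, inserting at the site v splits v into two active sites and
   kills each other active site w for which a relation surv v w fails.  The
   relation surv of the child is determined by that of its parent and by the
   order of the sites, by the same rule in both trees.  Hence the ordered set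
   of active sites with the relation surv determines the subtree.  It is the
   same for the one-letter permutation and for the empty signed permutation, so
   level n of the first tree, in S_{n+1}, and level n of the second one, in
   W_{C_n}, have the same size.

   Finally iota is injective, as every root is a sum of two of the weights
   +-e_i, and its image is the centralizer of w_0: a permutation which commutes
   with w_0 and is not the identity has a descent at some i <= n, and composing
   it with iota s_i increases the sum of the k tau(k). *)

Set Implicit Arguments.
Unset Strict Implicit.
Unset Printing Implicit Defensive.

Import Order.TTheory GRing.Theory Num.Theory.
Local Open Scope ring_scope.

(** * Words avoiding 4231 and 3142 *)

Ltac andb_ac := apply/idP/idP => ?;
  repeat match goal with H : is_true (_ && _) |- _ => case/andP: H => ? ? end;
  repeat (apply/andP; split); by [].

Section Words.
Implicit Types (s t x y z : seq int) (M : int).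

Definition mir s : seq int := [seq - a | a <- rev s].

Fixpoint no231 s : bool :=
  if s is b :: t then pairwise (fun c a => ~~ (a < b < c)) t && no231 t else true.

(* The site between s and t is not straddled by a descent of s: in s M t, with M a
   maximum, such a descent and a letter c of t would form 3142. *)
Definition nostrad s t : bool :=
  pairwise (fun a b => all (fun c => ~~ (b < c < a)) t) s.

Definition avoid s : Prop := forall a b c d : int, subseq [:: a; b; c; d] s ->
  ~~ [&& d < b, b < c & c < a] && ~~ [&& b < d, d < a & a < c].

Definition below M s : bool := all (fun a => `|a| < M) s.

Lemma mir_cat s t : mir (s ++ t) = mir t ++ mir s.
Proof. by rewrite /mir rev_cat map_cat. Qed.

Lemma mir_cons a s : mir (a :: s) = mir s ++ [:: - a].
Proof. by rewrite -cat1s mir_cat. Qed.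

Lemma mirK : involutive mir.
Proof.
move=> s; rewrite /mir -map_rev revK -map_comp -[RHS]map_id.
by apply: eq_map => a /=; rewrite opprK.
Qed.

Lemma mem_mir s a : (a \in mir s) = (- a \in s).
Proof.
apply/mapP/idP => [[b]|H]; first by rewrite mem_rev => ? ->; rewrite opprK.
by exists (- a); rewrite ?mem_rev ?opprK.
Qed.

Lemma below_cat M s t : below M (s ++ t) = below M s && below M t.
Proof. exact: all_cat. Qed.

Lemma below_mir M s : below M (mir s) = below M s.
Proof. by rewrite /below all_map all_rev; apply: eq_all => a /=; rewrite normrN. Qed.

Lemma below_lt M s a : below M s -> a \in s -> - M < a < M.
Proof. by move=> /allP H /H; lia. Qed.

Lemma pairwise_in (T : eqType) (e f : rel T) (s : seq T) :
  {in s &, e =2 f} -> pairwise e s = pairwise f s.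
Proof.
elim: s => //= a s IH H; congr (_ && _).
  by apply: eq_in_all => b bs; apply: H; rewrite inE ?eqxx ?bs ?orbT.
by apply: IH => b c bs cs; apply: H; rewrite inE ?bs ?cs orbT.
Qed.

Lemma pairwise_true (T : eqType) (e : rel T) (s : seq T) :
  {in s &, forall a b, e a b} -> pairwise e s = true.
Proof. by move=> H; elim: s H => //= a s IH H; rewrite IH ?andbT;
 [apply/allP=> b bs | move=> b c bs cs]; apply: H; rewrite inE ?eqxx ?bs ?cs ?orbT.
Qed.

Lemma belowW M s : below M s -> below (M + 1) s.
Proof. by apply: sub_all => a; lia. Qed.

(** [M] can only be the 3 of a 231, with the 2 in [s] and the 1 in [t]. The bound on [t] is [M + 1]
    so that, in a symmetrized word, [t] may contain [- M]. *)
Lemma no231_cat_max M s t : below M s -> below (M + 1) t ->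
  no231 (s ++ M :: t) = no231 (s ++ t) && allrel (fun a b => a <= b) s t.
Proof.
move=> Ms Mt; elim: s Ms => [|b s IH] /=.
  move=> _; rewrite allrel0l andbT pairwise_true // => a c ia ic.
  by have := below_lt Mt ia; lia.
case/andP=> Mb Ms; rewrite {}IH // allrel_consl !pairwise_cat /= allrel_consr.
have -> : all (fun c => ~~ (M < b < c)) s.
  by apply/allP=> a; lia.
have -> : all (fun a => ~~ (a < b < M)) t = all (fun a => b <= a) t.
  by apply: eq_in_all => a _; lia.
by rewrite /=; andb_ac.
Qed.

(** [- M] can only be the 1 of a 231, and then the 2 and the 3 form an ascent of [s]. *)
Lemma no231_cat_min M s t : below M s -> below (M + 1) t ->
  no231 (s ++ - M :: t) = no231 (s ++ t) && pairwise (fun a b => b <= a) s.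
Proof.
move=> Ms Mt; elim: s Ms => [|b s IH] /=.
  move=> _; rewrite andbT pairwise_true // => a c ia ic.
  by have := below_lt Mt ic; lia.
case/andP=> Mb Ms; rewrite {}IH // !pairwise_cat /= allrel_consr.
have -> : all (fun a => ~~ (a < b < - M)) t.
  by apply/allP=> a; lia.
have -> : all (fun c => ~~ (- M < b < c)) s = all (fun a => a <= b) s.
  by apply: eq_in_all => a _; lia.
by rewrite /=; andb_ac.
Qed.

Lemma nostrad_catr_max M s t u : below (M + 1) s ->
  nostrad s (t ++ M :: u) = nostrad s (t ++ u).
Proof.
move=> Ms; apply: pairwise_in => a b ia ib; rewrite !all_cat /=.
by have -> : ~~ (b < M < a) by have := below_lt Ms ia; lia.
Qed.

Lemma nostrad_catr_min M s t u : below (M + 1) s ->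
  nostrad s (t ++ - M :: u) = nostrad s (t ++ u).
Proof.
move=> Ms; apply: pairwise_in => a b ia ib; rewrite !all_cat /=.
by have -> : ~~ (b < - M < a) by have := below_lt Ms ib; lia.
Qed.

(** On the left of the site, [M] matters only as the top of a descent whose bottom is in [t]; in
    [nostrad_catl_min], [- M] matters only as the bottom of a descent whose top is in [s]. *)
Lemma nostrad_catl_max M s t u : below (M + 1) s -> below M u ->
  nostrad (s ++ M :: t) u = nostrad (s ++ t) u && allrel (fun a b => b <= a) t u.
Proof.
move=> Ms Mu; rewrite /nostrad !pairwise_cat /= allrel_consr.
have -> : all (fun a => all (fun c => ~~ (M < c < a)) u) s.
  by apply/allP=> a ia; apply/allP=> c ic; have := below_lt Ms ia; lia.
have -> : all (fun b => all (fun c => ~~ (b < c < M)) u) t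
    = allrel (fun a b => b <= a) t u.
  apply: eq_in_all => b _; apply: eq_in_all => c ic.
  by have := below_lt Mu ic; lia.
by rewrite /=; andb_ac.
Qed.

Lemma nostrad_catl_min M s t u : below (M + 1) t -> below M u ->
  nostrad (s ++ - M :: t) u = nostrad (s ++ t) u && allrel (fun a b => a <= b) s u.
Proof.
move=> Mt Mu; rewrite /nostrad !pairwise_cat /= allrel_consr.
have -> : all (fun b => all (fun c => ~~ (b < c < - M)) u) t.
  by apply/allP=> a ia; apply/allP=> c ic; have := below_lt Mt ia; lia.
have -> : all (fun a => all (fun c => ~~ (- M < c < a)) u) s
    = allrel (fun a b => a <= b) s u.
  apply: eq_in_all => b _; apply: eq_in_all => c ic.
  by have := below_lt Mu ic; lia.
by rewrite /=; andb_ac.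
Qed.

Lemma pairwise_subseqP (T : eqType) (e : rel T) (s : seq T) :
  reflect (forall a b, subseq [:: a; b] s -> e a b) (pairwise e s).
Proof.
elim: s => [|c s IH] /=; first by apply: (iffP idP) => // _ a b /eqP.
apply: (iffP andP) => [[/allP H /IH H'] a b|H].
  by case: eqP => [-> | _]; [rewrite sub1seq; apply: H | apply: H'].
split; first by apply/allP=> b bs; apply: H; rewrite eqxx sub1seq.
apply/IH=> a b ab; apply: H; case: eqP => // _.
by rewrite sub1seq (mem_subseq ab) // !inE eqxx orbT.
Qed.

Lemma no231P s :
  reflect (forall b c a : int, subseq [:: b; c; a] s -> ~~ (a < b < c)) (no231 s).
Proof.
elim: s => [|d s IH] /=; first by apply: (iffP idP) => // _ a b c /eqP.
apply: (iffP andP) => [[/pairwise_subseqP H /IH H'] b c a|H].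
  by case: eqP => [-> | _]; [apply: H | apply: H'].
split; first by apply/pairwise_subseqP=> b c bs; apply: H; rewrite eqxx.
apply/IH=> a b c ab; apply: H; case: eqP => // _.
by apply: subseq_trans ab; apply: subseq_cons.
Qed.

Lemma subseq_notin (M : int) (u s t : seq int) : M \notin u ->
  subseq u (s ++ M :: t) = subseq u (s ++ t).
Proof.
move=> Mu; apply/idP/idP=> [us|/subseq_trans->//]; last first.
  by rewrite subseq_cat2l subseq_cons.
have : subseq u (filter (predC1 M) (s ++ M :: t)).
  by rewrite subseq_filter us andbT; apply/allP=> a; apply: contraTneq => ->.
rewrite filter_cat /= eqxx /= -filter_cat => /subseq_trans-> //.
exact: filter_subseq.
Qed.

(** In a forbidden pattern [M] can only be the 4. As the first letter of 4231 it leaves a 231 in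
    [t]; as the third letter of 3142 it leaves a descent of [s] straddling a letter of [t]. *)
Lemma avoid_cat_max M s t : uniq (s ++ M :: t) ->
  all (fun a => a < M) (s ++ t) ->
  avoid (s ++ M :: t) <-> avoid (s ++ t) /\ no231 t && nostrad s t.
Proof.
move=> Us Mst; have lt a : a \in s ++ M :: t -> a != M -> a < M.
  move=> ia aM; have : a \in s ++ t by move: ia aM; rewrite !mem_cat inE; case: eqP.
  by move/(allP Mst).
have piv u v : subseq (u ++ M :: v) (s ++ M :: t) = subseq u s && subseq v t.
  exact: uniq_subseq_pivot Us.
have Mst' : M \notin s ++ t by apply/negP=> /(allP Mst); lia.
have ltst a : a \in s ++ t -> a < M by move=> /(allP Mst).
split=> [H|[H /andP[/no231P H1 /pairwise_subseqP H2]] a b c d Habcd].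
  split; last (apply/andP; split).
  - move=> a b c d abcd; apply: H; rewrite subseq_notin //.
    by apply: contra Mst'; apply: mem_subseq abcd _.
  - apply/no231P=> b c a bca.
    have := H M b c a; rewrite (piv [::]) sub0seq => /(_ bca).
    have : c \in t by rewrite (mem_subseq bca) // !inE eqxx orbT.
    by move=> ct; have := ltst c; rewrite mem_cat ct orbT => /(_ isT); lia.
  apply/pairwise_subseqP=> a b ab; apply/allP=> c ct.
  have := H a b M c; rewrite (piv [:: a; b]) ab sub1seq ct => /(_ isT).
  have : a \in s by rewrite (mem_subseq ab) // !inE eqxx.
  by move=> sa; have := ltst a; rewrite mem_cat sa => /(_ isT); lia.
have [aM|aM] := eqVneq a M.
  move: Habcd; rewrite aM (piv [::]) sub0seq => Hbcd.
  by have := H1 _ _ _ Hbcd; have := ltst c;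
    rewrite mem_cat (mem_subseq Hbcd) ?inE ?eqxx ?orbT // => /(_ isT); lia.
have [cM|cM] := eqVneq c M.
  move: Habcd; rewrite cM (piv [:: a; b]) sub1seq => /andP[Hab dt].
  by have /allP/(_ _ dt) := H2 _ _ Hab; have := ltst a;
    rewrite mem_cat (mem_subseq Hab) ?inE ?eqxx ?orbT // => /(_ isT); lia.
have aM' : a < M by apply: lt aM; rewrite (mem_subseq Habcd) // !inE eqxx ?orbT.
have cM' : c < M by apply: lt cM; rewrite (mem_subseq Habcd) // !inE eqxx ?orbT.
have [bM|bM] := eqVneq b M; first by lia.
have [dM|dM] := eqVneq d M; first by lia.
apply: H; rewrite -(@subseq_notin M) // !inE !negb_or.
by rewrite ![M == _]eq_sym aM bM cM dM.
Qed.

(** Both 4231 and 3142 are fixed by reversal followed by complement. *)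
Lemma avoid_mir s : avoid (mir s) <-> avoid s.
Proof.
suff imp u : avoid u -> avoid (mir u) by split=> [/imp|/imp//]; rewrite mirK.
move=> H a b c d /(map_subseq -%R); rewrite -subseq_rev.
have -> : rev [seq - i | i <- mir u] = u by rewrite -map_rev; apply: mirK.
by move/H=> /=; lia.
Qed.

Lemma avoid_cat_min M s t : uniq (s ++ - M :: t) ->
  all (fun a => - M < a) (s ++ t) ->
  avoid (s ++ - M :: t) <->
  avoid (s ++ t) /\ no231 (mir s) && nostrad (mir t) (mir s).
Proof.
have mirE : mir (s ++ - M :: t) = mir t ++ M :: mir s.
  by rewrite mir_cat mir_cons opprK -catA.
move=> Us Mst; rewrite -avoid_mir -(avoid_mir (s ++ t)) mirE mir_cat.
apply: avoid_cat_max; last first.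
  by rewrite -mir_cat; apply/allP=> a; rewrite mem_mir => /(allP Mst); lia.
by rewrite -mirE map_inj_uniq ?rev_uniq //; apply: oppr_inj.
Qed.

Definition sym s := mir s ++ s.

(* actP x y and actN x y say that M and - M, with M a new maximum, may be inserted
   between x and y when sym (x ++ y) is avoiding: see avoid_sym_max and
   avoid_sym_min. *)
Definition actP x y :=
  [&& all (fun a => 0 < a) y, no231 y & nostrad (sym x) y].

Definition actN x y :=
  [&& pairwise (fun a b => b <= a) (sym x), no231 (sym x ++ y)
    & nostrad (mir y) (sym x ++ y)].

Lemma uniq_sym s : uniq (map absz s) -> 0 \notin s -> uniq (sym s).
Proof.
move=> Us s0; rewrite cat_uniq map_inj_uniq ?rev_uniq; last exact: oppr_inj.
rewrite (map_uniq Us) /= andbT; apply/hasPn=> a sa; apply/negP.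
rewrite mem_mir => sa'; suff a0 : a = 0 by rewrite -a0 sa in s0.
elim: s Us sa sa' {s0} => //= b s IH /andP[bs Us]; rewrite !inE.
have mem c : c \in s -> absz c \in map absz s by exact: map_f.
case: (eqVneq a b) => [->|ab] /=.
  by case: eqP => [E _ _|_ _ /mem]; [lia | rewrite abszN (negPf bs)].
move=> sa; case: eqP => [E|_]; last exact: IH.
by have := mem _ sa; rewrite -abszN E (negPf bs).
Qed.

Lemma mir_sym s : mir (sym s) = sym s.
Proof. by rewrite /sym mir_cat mirK. Qed.

Lemma uniq_sym_cat M x y : uniq (map absz (x ++ y)) -> 0 \notin x ++ y ->
  below `|M| (x ++ y) -> M != 0 -> uniq (sym (x ++ M :: y)).
Proof.
move=> Uxy xy0 Mxy M0; have P : perm_eq (x ++ M :: y) (M :: x ++ y).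
  by rewrite -cat1s perm_catCA.
apply: uniq_sym; last by rewrite (perm_mem P) inE negb_or eq_sym M0.
rewrite (perm_uniq (perm_map _ P)) /= Uxy andbT.
by apply/mapP=> [[a /(below_lt Mxy)]]; lia.
Qed.

(** The symmetrized word reads [mir y], [- M], [sym x], [M], [y]. First [M] is removed by
    [avoid_cat_max], then [- M] by [avoid_cat_min]. *)
Lemma avoid_sym_max M x y : uniq (map absz (x ++ y)) -> 0 \notin x ++ y ->
  below M (x ++ y) -> 0 < M ->
  avoid (sym (x ++ M :: y)) <-> avoid (sym (x ++ y)) /\ actP x y.
Proof.
move=> Uxy xy0 Mxy M0.
have := uniq_sym_cat Uxy xy0 _ (lt0r_neq0 M0); rewrite gtr0_norm // => /(_ Mxy).
have Msxy : below M (mir y ++ mir x ++ x ++ y).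
  by rewrite catA below_cat -mir_cat below_mir Mxy.
have ltM a : a \in mir y ++ mir x ++ x ++ y -> - M < a < M.
  exact: below_lt.
have symE : sym (x ++ M :: y) = (mir y ++ - M :: sym x) ++ M :: y.
  by rewrite /sym mir_cat mir_cons -!catA /= -!catA.
rewrite symE => U; rewrite avoid_cat_max //; last first.
  apply/allP=> a; rewrite -!catA cat_cons mem_cat inE => ia.
  case: (eqVneq a (- M)) ia => [->|_ /=]; first by lia.
  by rewrite -mem_cat -!catA => /ltM/andP[].
have {}U : uniq (mir y ++ - M :: sym x ++ y).
  rewrite -cat_cons catA; apply: subseq_uniq U.
  by rewrite subseq_cat2l subseq_cons.
rewrite -catA cat_cons avoid_cat_min //; last first.
  by apply/allP=> a; rewrite -catA => /ltM/andP[].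
have -> : mir y ++ sym x ++ y = sym (x ++ y) by rewrite /sym mir_cat -!catA.
have /andP[My Mx] : below M y && below M (sym x).
  by move: Mxy; rewrite !below_cat below_mir andbb andbC.
rewrite mir_cat mirK mir_sym nostrad_catl_min ?belowW //.
rewrite /actP.
(* Comparing a letter [a] of [y] with its own mirror gives [- a <= a], hence [0 < a] because 0 does
   not occur. *)
have -> : all (fun a => 0 < a) y = allrel (fun a b => a <= b) (mir y) y.
  apply/allP/allrelP => [H a b| H a ia].
    by rewrite mem_mir => /H + /H; lia.
  have := H (- a) a; rewrite mem_mir opprK => /(_ ia ia).
  have : a != 0 by apply: contraNneq xy0 => <-; rewrite mem_cat ia orbT.
  lia.
split=> [[[H1 /andP[H2 H3]] /andP[_ /andP[_ H5]]]|[H1 /and3P[H2 H3 H4]]].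
  split=> //; rewrite H5 H2; move: H3.
  by rewrite /nostrad !pairwise_cat => /and3P[].
(* No letter of [mir y] exceeds a letter of [y], so none is the top of a descent straddling a letter
   of [y]. *)
have H5 : nostrad (mir y ++ sym x) y.
  rewrite /nostrad pairwise_cat [X in [&& _, _ & X]]H4 andbT.
  apply/andP; split; last first.
    by apply: pairwise_true => a b /= ia ib; apply/allP=> c /((allrelP H2) _ _ ia); lia.
  by apply/allrelP => a b /= ia ib; apply/allP=> c /((allrelP H2) _ _ ia); lia.
by rewrite H3 H5 H2.
Qed.

(** Here [M] comes first: the word reads [mir y], [M], [sym x], [- M], [y]. What follows [M] must
    avoid 231 with [- M] as its 1, whence the condition in [actN] that [sym x] decreases. *)
Lemma avoid_sym_min M x y : uniq (map absz (x ++ y)) -> 0 \notin x ++ y ->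
  below M (x ++ y) -> 0 < M ->
  avoid (sym (x ++ - M :: y)) <-> avoid (sym (x ++ y)) /\ actN x y.
Proof.
move=> Uxy xy0 Mxy M0.
have := @uniq_sym_cat (- M) x y Uxy xy0.
rewrite normrN gtr0_norm // oppr_eq0 lt0r_neq0 // => /(_ Mxy isT).
have ltM a : a \in mir y ++ mir x ++ x ++ y -> - M < a < M.
  by apply: below_lt; rewrite catA below_cat -mir_cat below_mir Mxy.
have symE : sym (x ++ - M :: y) = mir y ++ M :: (sym x ++ - M :: y).
  by rewrite /sym mir_cat mir_cons opprK -!catA /= -?catA.
have /andP[My Mx] : below M y && below M (sym x).
  by move: Mxy; rewrite !below_cat below_mir andbb andbC.
rewrite symE => U; rewrite avoid_cat_max //; last first.
  apply/allP=> a; rewrite catA mem_cat inE => ia.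
  case: (eqVneq a (- M)) ia => [->|_ /=]; first by lia.
  by rewrite -mem_cat -!catA => /ltM/andP[].
have {}U : uniq ((mir y ++ sym x) ++ - M :: y).
  by apply: subseq_uniq U; rewrite -catA subseq_cat2l subseq_cons.
rewrite catA avoid_cat_min //; last first.
  by apply/allP=> a; rewrite -!catA => /ltM/andP[].
have -> : (mir y ++ sym x) ++ y = sym (x ++ y) by rewrite /sym mir_cat -!catA.
rewrite mir_cat mirK mir_sym no231_cat_min ?belowW //.
rewrite nostrad_catr_min ?belowW ?below_mir //.
rewrite /actN; split=> [[[H1 /andP[H2 H3]] /andP[/andP[H4 H5] H6]]|].
  by rewrite H5 H4.
by case=> H1 /and3P[H2 H3 H4]; rewrite H4 H3 H2.
Qed.

End Words.

(** * Insertion sites and the survival relation *)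

Ltac solve_sizes := solve [by [] | by rewrite -?catA | rewrite /= ?size_cat /=; lia].

Section Tree.
Implicit Types (r s t x y z : seq int) (v w a b : int).

Definition signed_perm r : bool := perm_eq (map absz r) (iota 1 (size r)).

Definition newval r : int := (size r).+1.

(* The site Posz k inserts a new maximum M at index k, and Negz k inserts - M there,
   that is, inserts M at the mirror place of sym r.  With this coding, the order
   of int is the left-to-right order in sym r of the places of M. *)
Definition child r v : seq int :=
  match v with
  | Posz k => take k r ++ newval r :: drop k r
  | Negz k => take k r ++ - newval r :: drop k r
  end.

(* When v and w are active in r, surv r v w says that w remains active once v has
   been used. *)
Definition surv r v w : bool :=
  match v, w with
  | Posz i, Posz j =>
      if (j < i)%N then allrel (fun a b => a <= b) (drop j (take i r)) (drop i r)
      else allrel (fun a b => b <= a) (drop i (take j r)) (drop j r)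
  | Posz i, Negz j =>
      (j <= i)%N && allrel (fun a b => `|a| <= b) (take i r) (drop i r)
  | Negz i, Posz j => j == size r
  | Negz i, Negz j =>
      (j < i)%N && allrel (fun a b => a + b <= 0) (drop j (take i r)) (drop i r)
  end.

(* The site v is split into lower v and upper v, and shift w is the new name of a
   site w > v; the sites w < v keep their name. *)
Definition lower v : int := if 0 <= v then v else v - 1.
Definition upper v : int := if 0 <= v then v + 1 else v.
Definition shift w : int := if 0 <= w then w + 1 else w.

Definition in_range n v : bool := (- (n.+1%:Z) <= v) && (v <= n%:Z).

Lemma shift_pos (k : nat) : shift k = k.+1.
Proof. by rewrite /shift /=; lia. Qed.

Lemma lower_neg (k : nat) : lower (Negz k) = Negz k.+1.
Proof. by rewrite /lower /=; lia. Qed.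

Lemma signed_perm_uniq r : signed_perm r -> uniq (map absz r).
Proof. by move/perm_uniq->; apply: iota_uniq. Qed.

Lemma signed_perm_bound r a : signed_perm r -> a \in r -> 0 < `|a| <= size r.
Proof. by move=> /perm_mem H /(map_f absz); rewrite H mem_iota; lia. Qed.

Lemma signed_perm0 r : signed_perm r -> 0 \notin r.
Proof. by move=> Hr; apply/negP=> /(signed_perm_bound Hr); rewrite normr0 ltxx. Qed.

Lemma signed_perm_below r : signed_perm r -> below (newval r) r.
Proof. by move=> Hr; apply/allP=> a /(signed_perm_bound Hr); rewrite /newval; lia. Qed.

Lemma split_seq (k : nat) s : (k <= size s)%N -> exists x y, s = x ++ y /\ k = size x.
Proof. by move=> ks; exists (take k s), (drop k s); rewrite cat_take_drop size_takel. Qed.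

Lemma split_seq2 (i j : nat) s : (i <= j <= size s)%N -> exists x y z,
  [/\ s = x ++ y ++ z, i = size x & j = (size x + size y)%N].
Proof.
case/andP=> ij js; have [xy [z [sE jE]]] := split_seq js.
have [x [y [xyE iE]]] : exists x y, xy = x ++ y /\ i = size x by apply: split_seq; lia.
by exists x, y, z; rewrite sE jE iE xyE size_cat catA.
Qed.

Lemma split_seq3 (i j k : nat) s : (i <= j <= k)%N -> (k <= size s)%N ->
  exists x y z t, [/\ s = x ++ y ++ z ++ t, i = size x,
    j = (size x + size y)%N & k = (size x + size y + size z)%N].
Proof.
move=> ijk ks; have [u [t [sE kE]]] := split_seq ks.
have [x [y [z [uE iE jE]]]] : exists x y z,
  [/\ u = x ++ y ++ z, i = size x & j = (size x + size y)%N] by apply: split_seq2; lia.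
by exists x, y, z, t; rewrite sE kE iE jE uE !size_cat -!catA addnA.
Qed.

Lemma neq_nil s : (0 < size s)%N -> s != [::].
Proof. by case: s. Qed.

Lemma child_pos x y : child (x ++ y) (Posz (size x)) = x ++ newval (x ++ y) :: y.
Proof. by rewrite /child take_size_cat ?drop_size_cat. Qed.

Lemma child_neg x y : child (x ++ y) (Negz (size x)) = x ++ - newval (x ++ y) :: y.
Proof. by rewrite /child take_size_cat ?drop_size_cat. Qed.

Lemma surv_pos_lt r x y z (i j : nat) : r = x ++ y ++ z -> j = size x ->
  i = (size x + size y)%N -> (j < i)%N ->
  surv r i j = allrel (fun a b => a <= b) y z.
Proof.
move=> -> -> -> /= ->; rewrite catA -size_cat take_size_cat // drop_size_cat //.
by rewrite drop_size_cat.
Qed.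

Lemma surv_pos_gt r x y z (i j : nat) : r = x ++ y ++ z -> i = size x ->
  j = (size x + size y)%N ->
  surv r i j = allrel (fun a b => b <= a) y z.
Proof.
move=> -> -> -> /=; rewrite ltnNge leq_addr /=.
by rewrite catA -size_cat take_size_cat // !drop_size_cat.
Qed.

Lemma surv_pos_neg r x y (i j : nat) : r = x ++ y -> i = size x ->
  surv r i (Negz j) = (j <= i)%N && allrel (fun a b => `|a| <= b) x y.
Proof. by move=> -> -> /=; rewrite take_size_cat // drop_size_cat. Qed.

Lemma surv_neg r x y z (i j : nat) : r = x ++ y ++ z -> j = size x ->
  i = (size x + size y)%N -> (j < i)%N ->
  surv r (Negz i) (Negz j) = allrel (fun a b => a + b <= 0) y z.
Proof.
move=> -> -> -> /= ->; rewrite catA -size_cat take_size_cat // drop_size_cat //.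
by rewrite drop_size_cat.
Qed.

(** This is the first clause of [actN]; [surv_shift] uses it to compare two letters that both
    precede the inserted [- newval r]. *)
Definition descending_if_neg r v : bool :=
  if v is Negz k then pairwise (fun a b => b <= a) (sym (take k r)) else true.

Lemma allrel_nil_max M y t z : below M z ->
  allrel (fun a b => a <= b) (y ++ M :: t) z = (size z == 0)%N.
Proof.
case: z => [|c z] /=; first by rewrite allrel0r.
case/andP=> cM _; apply/negP=> /allrelP/(_ M c).
by rewrite mem_cat !inE !eqxx orbT => /(_ isT isT); lia.
Qed.

(** A letter of [y] and a letter of [z] would be bounded by each other, hence equal, against
    uniqueness. *)
Lemma allrel_nil_uniq y y' z : y != [::] -> uniq (y ++ z) ->
  allrel (fun a b => a <= b) y z -> {subset y <= y'} ->
  allrel (fun a b => b <= a) y' z = (size z == 0)%N.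
Proof.
case: y => // a y _ Uyz H sub; case: z => [|c z] /= in Uyz H *.
  by rewrite allrel0r.
apply/negP=> /allrelP/(_ a c); rewrite sub ?inE ?eqxx // => /(_ isT isT) ca.
move/allrelP: H => /(_ a c); rewrite !inE !eqxx => /(_ isT isT) ac.
have E : a = c by lia.
by case/andP: Uyz => /negP[]; rewrite mem_cat E inE eqxx orbT.
Qed.

Lemma allrel_nil_uniq' y z : y != [::] -> uniq (y ++ z) ->
  allrel (fun a b => b <= a) y z ->
  allrel (fun a b => a <= b) y z = (size z == 0)%N.
Proof.
case: y => // a y _ Uyz H; case: z => [|c z] /= in Uyz H *.
  by rewrite allrel0r.
apply/negP=> /allrelP/(_ a c); rewrite !inE !eqxx => /(_ isT isT) ac.
move/allrelP: H => /(_ a c); rewrite !inE !eqxx => /(_ isT isT) ca.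
have E : a = c by lia.
by case/andP: Uyz => /negP[]; rewrite mem_cat E inE eqxx orbT.
Qed.

Lemma allrel_ge_max M y z t : y != [::] -> below M y ->
  allrel (fun a b => b <= a) y (z ++ M :: t) = false.
Proof.
case: y => // a y _ /= /andP[aM _]; apply/negP=> /allrelP/(_ a M).
by rewrite mem_cat !inE !eqxx orbT => /(_ isT isT); lia.
Qed.

Lemma allrel_sum_max M y z t : y != [::] -> below M y ->
  allrel (fun a b => a + b <= 0) y (z ++ M :: t) = false.
Proof.
case: y => // a y _ /= /andP[aM _]; apply/negP=> /allrelP/(_ a M).
by rewrite mem_cat !inE !eqxx orbT => /(_ isT isT); lia.
Qed.

Lemma below_subset M s t : below M t -> {subset s <= t} -> below M s.
Proof. by move=> /allP H sub; apply/allP=> a /sub/H. Qed.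

Lemma size_child r v : size (child r v) = (size r).+1.
Proof.
by rewrite /child; case: v => k; rewrite size_cat /= addnS -size_cat cat_take_drop.
Qed.

(** * The survival relation of a child in terms of that of its parent *)

Section Child.
Variables (r : seq int) (v : int).
Hypothesis Hr : signed_perm r.
Hypothesis range_v : in_range (size r) v.
Hypothesis Hv : descending_if_neg r v.
Local Notation r' := (child r v).

(** A negative [v] kills every site on its left, so [v] is nonnegative here and the new maximum
    stands to the right of both sites. Being above all older letters, it leaves the effect of [b] on
    [a] unchanged, while [a] kills [b]. *)
Lemma surv_child_lo a b : a < b -> b < v -> in_range (size r) a ->
  surv r v a -> surv r v b ->
  (surv r' b a = surv r b a) * (surv r' a b = false).
Proof.
move: (signed_perm_below Hr) (size_child r v) (signed_perm_uniq Hr).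
case: v range_v Hv => k; last by case: a b => i [] j //=; rewrite /in_range; lia.
rewrite /in_range => rk _ bel sz uq.
case: a => i; case: b => j ij jk ra sa sb; rewrite /in_range in ra; try lia.
- have [x [y [z [t [E si sj sk]]]]] : exists x y z t, [/\ r = x ++ y ++ z ++ t,
    i = size x, j = (size x + size y)%N & k = (size x + size y + size z)%N].
    by apply: split_seq3; lia.
  have y0 : y != [::] by apply: neq_nil; lia.
  have bely : below (newval r) y.
    by apply: (below_subset bel) => c cy; rewrite E !mem_cat cy orbT.
  have r'E : child r k = x ++ y ++ z ++ newval r :: t.
    have := child_pos (x ++ y ++ z) t; rewrite -!catA -E => <-.
    by rewrite sk !size_cat addnA.
  rewrite (@surv_pos_lt r x y (z ++ t) j i); [|solve_sizes..].
  rewrite (@surv_pos_lt _ x y (z ++ newval r :: t) j i); [|solve_sizes..].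
  rewrite (@surv_pos_gt _ x y (z ++ newval r :: t) i j); [|solve_sizes..].
  rewrite allrel_ge_max // !allrel_catr allrel_consr /=.
  suff -> : all (fun a => a <= newval r) y by [].
  by apply: sub_all bely => c; lia.
- have [x [y [z [E sj sk]]]] : exists x y z,
    [/\ r = x ++ y ++ z, j = size x & k = (size x + size y)%N].
    by apply: split_seq2; lia.
  have r'E : child r k = x ++ y ++ newval r :: z.
    by have := child_pos (x ++ y) z; rewrite -!catA -E => <-; rewrite sk size_cat.
  rewrite (@surv_pos_neg r x (y ++ z)) // (@surv_pos_neg _ x (y ++ newval r :: z)) //.
  split; last by rewrite /surv; lia.
  rewrite !allrel_catr allrel_consr.
  suff -> : all (fun a => `|a| <= newval r) x by [].
  apply/allP=> c cx; have /allP/(_ c) := bel; rewrite E mem_cat cx.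
  by move=> /(_ isT); lia.
have ik : (i <= k)%N by case/andP: sa.
have [x [y [z [t [E sj si sk]]]]] : exists x y z t, [/\ r = x ++ y ++ z ++ t,
  j = size x, i = (size x + size y)%N & k = (size x + size y + size z)%N].
  by apply: split_seq3; lia.
have y0 : y != [::] by apply: neq_nil; lia.
have bely : below (newval r) y.
  by apply: (below_subset bel) => c cy; rewrite E !mem_cat cy orbT.
have r'E : child r k = x ++ y ++ z ++ newval r :: t.
  have := child_pos (x ++ y ++ z) t; rewrite -!catA -E => <-.
  by rewrite sk !size_cat addnA.
rewrite (@surv_neg _ x y (z ++ newval r :: t) i j); [|solve_sizes..].
rewrite allrel_sum_max //; split=> //.
by rewrite /surv; have -> : (i < j)%N = false by lia.
Qed.

Lemma surv_child_lower a : a < v -> surv r v a ->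
  surv r' (lower v) a * (surv r' a (lower v) = false).
Proof.
move: (signed_perm_below Hr) (size_child r v).
case: v range_v => k; last by case: a => i //=; lia.
rewrite /in_range => rk bel sz; have -> : lower k = k by [].
case: a => i ik sa.
  have [x [y [z [E si sk]]]] : exists x y z,
    [/\ r = x ++ y ++ z, i = size x & k = (size x + size y)%N].
    by apply: split_seq2; lia.
  have y0 : y != [::] by apply: neq_nil; lia.
  have bely : below (newval r) y.
    by apply: (below_subset bel) => c cy; rewrite E !mem_cat cy orbT.
  have r'E : child r k = x ++ y ++ newval r :: z.
    by have := child_pos (x ++ y) z; rewrite -!catA -E => <-; rewrite sk size_cat.
  move: sa; rewrite (@surv_pos_lt r x y z k i); [|solve_sizes..].
  rewrite (@surv_pos_lt _ x y (newval r :: z) k i); [|solve_sizes..].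
  rewrite (@surv_pos_gt _ x y (newval r :: z) i k); [|solve_sizes..].
  rewrite (allrel_ge_max [::]) // allrel_consr => ->; split=> //.
  by rewrite andbT; apply: sub_all bely => c; lia.
have [x [y [E sk]]] : exists x y, r = x ++ y /\ k = size x by apply: split_seq; lia.
have r'E : child r k = x ++ newval r :: y by have := child_pos x y; rewrite -E sk.
move: sa; rewrite (@surv_pos_neg r x y) // (@surv_pos_neg _ x (newval r :: y)) //.
case/andP=> -> H; rewrite allrel_consr H andbT; split; last by rewrite /surv sz; lia.
apply/allP=> c cx; have /allP/(_ c) := bel; rewrite E mem_cat cx.
by move=> /(_ isT); lia.
Qed.

(** The new maximum stands between the two sites, so each kills the other as soon as a letter
    follows [shift w]. Otherwise [shift w] is the rightmost site [(size r).+1], and both survive. *)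
Lemma surv_child_shift a w : a < v -> surv r v a ->
  v <= w -> (w == v) || surv r v w -> in_range (size r) w ->
  (surv r' (shift w) a = (shift w == (size r).+1)) *
  (surv r' a (shift w) = (shift w == (size r).+1)).
Proof.
move: (signed_perm_below Hr) (size_child r v) (signed_perm_uniq Hr).
case: v range_v => k; last by case: a => i // _ _ _ _ ik /andP[]; lia.
rewrite /in_range => rk bel sz uq av sa; case: w => j // kj _ /andP[_ jr].
rewrite shift_pos.
case: a av sa => i ik sa.
  have [x [y [z [t [E si sk sj]]]]] : exists x y z t, [/\ r = x ++ y ++ z ++ t,
    i = size x, k = (size x + size y)%N & j = (size x + size y + size z)%N].
    by apply: split_seq3; lia.
  have y0 : y != [::] by apply: neq_nil; lia.
  have belt : below (newval r) t.
    by apply: (below_subset bel) => c cy; rewrite E !mem_cat cy !orbT.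
  have r'E : child r k = x ++ (y ++ newval r :: z) ++ t.
    have := child_pos (x ++ y) (z ++ t); rewrite -!catA /= -E => <-.
    by rewrite sk size_cat.
  have jE : (Posz j.+1 == (size r).+1) = (size t == 0)%N.
    by rewrite E sj !size_cat; lia.
  rewrite (@surv_pos_lt _ x (y ++ newval r :: z) t j.+1 i); [|solve_sizes..].
  rewrite (@surv_pos_gt _ x (y ++ newval r :: z) t i j.+1); [|solve_sizes..].
  move: sa; rewrite (@surv_pos_lt r x y (z ++ t) k i); [|solve_sizes..].
  rewrite allrel_catr => /andP[_ H]; rewrite allrel_nil_max // jE; split=> //.
  apply: (allrel_nil_uniq y0) => //; last by move=> c cy; rewrite mem_cat cy.
  apply: subseq_uniq (map_uniq uq); rewrite E; apply: subseq_trans (suffix_subseq _ _).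
  by rewrite subseq_cat2l suffix_subseq.
have [x [z [t [E sk sj]]]] : exists x y z,
  [/\ r = x ++ y ++ z, k = size x & j = (size x + size y)%N] by apply: split_seq2; lia.
have r'E : child r k = (x ++ newval r :: z) ++ t.
  by have := child_pos x (z ++ t); rewrite -E sk -catA.
rewrite (@surv_pos_neg _ (x ++ newval r :: z) t) //; last by rewrite size_cat /=; lia.
have jE : (Posz j.+1 == (size r).+1) = (size t == 0)%N.
  by rewrite E sj !size_cat; lia.
split; last by rewrite /surv sz.
have -> : (i <= j.+1)%N by case/andP: sa => ? _; lia.
rewrite jE; case: t E {r'E jE} => [|c t] E; first by rewrite allrel0r.
apply/negP=> /allrelP/(_ (newval r) c); rewrite mem_cat !inE !eqxx orbT => /(_ isT isT).
by have /allP/(_ c) := bel; rewrite E !mem_cat inE eqxx !orbT => /(_ isT); lia.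
Qed.

(** The case [w = v] is that of the pair [lower v], [upper v], because [upper v] is [shift v]. *)
Lemma surv_lower_shift w :
  v <= w -> (w == v) || surv r v w -> in_range (size r) w ->
  surv r' (lower v) (shift w) *
  (surv r' (shift w) (lower v) = (shift w == (size r).+1)).
Proof.
move: (signed_perm_below Hr) (size_child r v).
case: v range_v => k; rewrite /in_range => rk bel sz.
  case: w => j // kj sw /andP[_ jr].
  rewrite shift_pos.
  have -> : lower k = k by [].
  have [x [z [t [E sk sj]]]] : exists x y z,
    [/\ r = x ++ y ++ z, k = size x & j = (size x + size y)%N] by apply: split_seq2; lia.
  have r'E : child r k = x ++ (newval r :: z) ++ t.
    by have := child_pos x (z ++ t); rewrite -E sk.
  have belt : below (newval r) t.
    by apply: (below_subset bel) => c cy; rewrite E !mem_cat cy !orbT.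
  rewrite (@surv_pos_lt _ x (newval r :: z) t j.+1 k); [|solve_sizes..].
  rewrite (@surv_pos_gt _ x (newval r :: z) t k j.+1); [|solve_sizes..].
  rewrite (allrel_nil_max [::]) //; split; last by rewrite E sj !size_cat; lia.
  rewrite allrel_consl; apply/andP; split; first by apply: sub_all belt => c; lia.
  case/orP: sw => [/eqP jk|]; last by rewrite (@surv_pos_gt r x z t k j).
  by have /size0nil-> : size z = 0%N by lia.
rewrite lower_neg.
case: w => j kj sw /andP[jr jr'].
  (* After a negative insertion, the rightmost site is the only nonnegative one to survive. *)
  have jE : j = size r by case/orP: sw => [|/eqP//]; lia.
  rewrite shift_pos.
  rewrite jE eqxx /= sz eqxx; split=> //.
  by rewrite [X in allrel _ _ X]drop_oversize ?sz // allrel0r andbT; lia.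
have -> : shift (Negz j) = Negz j by [].
have [x [y [z [E sj sk]]]] : exists x y z,
  [/\ r = x ++ y ++ z, j = size x & k = (size x + size y)%N] by apply: split_seq2; lia.
have r'E : child r (Negz k) = x ++ (y ++ [:: - newval r]) ++ z.
  by have := child_neg (x ++ y) z; rewrite -!catA -E => <-; rewrite sk size_cat.
have belt : below (newval r) z.
  by apply: (below_subset bel) => c cy; rewrite E !mem_cat cy !orbT.
rewrite (@surv_neg _ x (y ++ [:: - newval r]) z k.+1 j); [|solve_sizes..].
split; last by rewrite /surv; lia.
rewrite allrel_catl allrel_consl allrel0l andbT; apply/andP; split; last first.
  by apply: sub_all belt => c; lia.
case/orP: sw => [/eqP jk|]; last first.
  by case: (ltnP j k) => jk; [rewrite (@surv_neg r x y z k j) | rewrite /surv; lia].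
by have /size0nil-> : size y = 0%N by lia.
Qed.

Lemma surv_shift w w' : v <= w -> w < w' ->
  (w == v) || surv r v w -> surv r v w' -> in_range (size r) w' ->
  surv r' (shift w) (shift w') *
  (surv r' (shift w') (shift w) = (shift w' == (size r).+1)).
Proof.
move: (signed_perm_below Hr) (size_child r v) (signed_perm_uniq Hr).
case: v range_v Hv => k; rewrite /in_range => rk Hk bel sz uq.
  case: w => j //; case: w' => l // kj jl _ sw /andP[_ jr].
  rewrite !shift_pos.
  have [x [y [z [t [E sk sj sl]]]]] : exists x y z t, [/\ r = x ++ y ++ z ++ t,
    k = size x, j = (size x + size y)%N & l = (size x + size y + size z)%N].
    by apply: split_seq3; lia.
  have z0 : z != [::] by apply: neq_nil; lia.
  have r'E : child r k = (x ++ newval r :: y) ++ z ++ t.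
    by have := child_pos x (y ++ z ++ t); rewrite -E sk -catA.
  rewrite (@surv_pos_lt _ (x ++ newval r :: y) z t l.+1 j.+1); [|solve_sizes..].
  rewrite (@surv_pos_gt _ (x ++ newval r :: y) z t j.+1 l.+1); [|solve_sizes..].
  move: sw; rewrite (@surv_pos_gt r x (y ++ z) t k l); [|solve_sizes..].
  rewrite allrel_catl => /andP[_ H]; rewrite H; split=> //.
  rewrite allrel_nil_uniq' //; first by rewrite E sl !size_cat; lia.
  apply: subseq_uniq (map_uniq uq); rewrite E.
  by apply: subseq_trans (suffix_subseq _ _); apply: suffix_subseq.
case: w => j kj jl sw sw' /andP[lr lr'].
  have jE : j = size r by case/orP: sw => [|/eqP//]; lia.
  by case: w' jl lr' {sw' lr} => l; lia.
have jk : (j <= k)%N by lia.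
have -> : shift (Negz j) = Negz j by [].
case: w' jl sw' lr lr' => l jl sw' lr lr'.
  have lE : l = size r by exact/eqP.
  rewrite shift_pos.
  rewrite lE eqxx /= sz eqxx; split=> //.
  by rewrite [X in allrel _ _ X]drop_oversize ?sz // allrel0r andbT; lia.
have -> : shift (Negz l) = Negz l by [].
have [x [y [z [t [E sl sj sk]]]]] : exists x y z t, [/\ r = x ++ y ++ z ++ t,
  l = size x, j = (size x + size y)%N & k = (size x + size y + size z)%N].
  by apply: split_seq3; lia.
have r'E : child r (Negz k) = x ++ y ++ z ++ - newval r :: t.
  have := child_neg (x ++ y ++ z) t; rewrite -!catA -E => <-.
  by rewrite sk !size_cat addnA.
rewrite (@surv_neg _ x y (z ++ - newval r :: t) j l); [|solve_sizes..].
split; last by rewrite /surv; lia.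
move: sw'; rewrite (@surv_neg r x (y ++ z) t k l); [|solve_sizes..].
rewrite allrel_catl => /andP[yt _]; rewrite allrel_catr allrel_consr yt andbT.
apply/andP; split; last first.
  apply/allP=> c cy; have /allP/(_ c) := bel; rewrite E !mem_cat cy orbT.
  by move=> /(_ isT); lia.
(* The letters of [y] and [z] lie in the prefix whose symmetrization decreases. There the mirror
   [- a] of a letter [a] of [y] precedes each [b] of [z], so [b <= - a]. *)
move: Hk; rewrite /descending_if_neg; have -> : take k r = x ++ y ++ z.
  by rewrite E sk !catA -addnA -!size_cat take_size_cat // !size_cat addnA.
rewrite pairwise_cat => /andP[/allrelP H _]; apply/allrelP=> a b ay bz.
have := H (- a) b; rewrite mem_mir opprK !mem_cat ay bz !orbT => /(_ isT isT).
by lia.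
Qed.

End Child.
End Tree.

(** * Active sites *)

Section Activity.
Implicit Types (r s t x y z : seq int) (v w a b : int).
Implicit Type act : seq int -> int -> bool.

(** The child has one site 0 that is no [shift w]. When [v < 0] it is neither [lower v] nor
    [upper v] either, whence a clause of its own. *)
Definition step_law act : Prop := forall r v,
  signed_perm r -> in_range (size r) v -> act r v ->
  [/\ descending_if_neg r v, act (child r v) (lower v) && act (child r v) (upper v),
      v < 0 -> act (child r v) 0 = false,
      forall w, in_range (size r).+1 w -> w < lower v ->
        act (child r v) w = act r w && surv r v w
    & forall w, in_range (size r) w -> v < w ->
        act (child r v) (shift w) = act r w && surv r v w].

(* Sites of the form Negz k do not exist for permutations. *)
Definition actA r v : bool :=
  if v is Posz k then no231 (drop k r) && nostrad (take k r) (drop k r) else false.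

Definition actS r v : bool :=
  match v with
  | Posz k => actP (take k r) (drop k r)
  | Negz k => actN (take k r) (drop k r)
  end.

Lemma actA_pos r x y (k : nat) : r = x ++ y -> k = size x ->
  actA r k = no231 y && nostrad x y.
Proof. by move=> -> -> /=; rewrite take_size_cat // drop_size_cat. Qed.

Lemma actS_pos r x y (k : nat) : r = x ++ y -> k = size x ->
  actS r k = actP x y.
Proof. by move=> -> -> /=; rewrite take_size_cat // drop_size_cat. Qed.

Lemma actS_neg r x y (k : nat) : r = x ++ y -> k = size x ->
  actS r (Negz k) = actN x y.
Proof. by move=> -> -> /=; rewrite take_size_cat // drop_size_cat. Qed.

Lemma nostrad_nil s : nostrad s [::].
Proof. by rewrite /nostrad pairwise_true. Qed.

Lemma upper_pos (k : nat) : upper k = k.+1.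
Proof. by rewrite /upper /=; lia. Qed.

Lemma surv_self r (k : nat) : surv r k k.
Proof. by rewrite /= ltnn drop_oversize ?allrel0l // size_take; case: ifP; lia. Qed.

Lemma step_actA : step_law actA.
Proof.
move=> r [k|//] Hr /andP[_ rk]; have bel := signed_perm_below Hr.
have [X [Y [E sk]]] : exists x y, r = x ++ y /\ k = size x by apply: split_seq; lia.
have r'E : child r k = X ++ newval r :: Y by have := child_pos X Y; rewrite -E sk.
have /andP[bX bY] : below (newval r) X && below (newval r) Y.
  by rewrite -below_cat -E.
rewrite (actA_pos E sk) => /andP[nY nXY].
(* The case [j = k] gives the activity of [upper k]. *)
have U (j : nat) : (k <= j <= size r)%N ->
    actA (child r k) j.+1 = actA r j && surv r k j.
  move=> kj; have [x [y [z [E' sx sj]]]] : exists x y z,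
    [/\ r = x ++ y ++ z, k = size x & j = (size x + size y)%N] by apply: split_seq2; lia.
  have r'E' : child r k = (x ++ newval r :: y) ++ z.
    by have := child_pos x (y ++ z); rewrite -E' sx -catA.
  rewrite (@surv_pos_gt _ x y z) // (@actA_pos r (x ++ y) z); [|solve_sizes..].
  rewrite (@actA_pos _ (x ++ newval r :: y) z); [|solve_sizes..].
  have /and3P[bx bY' bz] : [&& below (newval r) x, below (newval r) y & below (newval r) z].
    by rewrite -!below_cat -E'.
  by rewrite nostrad_catl_max ?belowW // andbA.
split=> //.
- rewrite (_ : lower k = k) // upper_pos (U k) ?surv_self; last by lia.
  rewrite (actA_pos E sk) nY nXY (actA_pos r'E sk).
  rewrite (no231_cat_max (s := [::])) ?belowW // nY allrel0l /=.
  by rewrite (nostrad_catr_max [::]) ?belowW // nXY.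
- move=> [j|j //] jr jk; rewrite (_ : lower k = k) // in jk.
  have [x [y [z [E' sx sj]]]] : exists x y z,
    [/\ r = x ++ y ++ z, j = size x & k = (size x + size y)%N] by apply: split_seq2; lia.
  have r'E' : child r k = x ++ (y ++ newval r :: z).
    by have := child_pos (x ++ y) z; rewrite -!catA -E' => <-; rewrite sj size_cat.
  rewrite (@surv_pos_lt _ x y z) // (@actA_pos r x (y ++ z)); [|solve_sizes..].
  rewrite (@actA_pos _ x (y ++ newval r :: z)); [|solve_sizes..].
  have /and3P[bx bY' bz] : [&& below (newval r) x, below (newval r) y & below (newval r) z].
    by rewrite -!below_cat -E'.
  rewrite no231_cat_max ?belowW // nostrad_catr_max ?belowW //.
  by rewrite -!andbA [X in _ && X]andbC.
move=> [j|j]; last by lia.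
by move=> /andP[_ jr] kj; rewrite shift_pos U //; lia.
Qed.

Lemma mir1 a : mir [:: a] = [:: - a].
Proof. by []. Qed.

Lemma sym_desc_max_false M x y : 0 < M ->
  pairwise (fun a b => b <= a) (sym (x ++ M :: y)) = false.
Proof.
move=> M0; rewrite pairwise_cat; apply/negP=> /andP[/allrelP/(_ (- M) M)].
by rewrite mem_mir opprK mem_cat inE eqxx orbT => /(_ isT isT); lia.
Qed.

Lemma sym_desc_min M x : below M x -> 0 < M ->
  pairwise (fun a b => b <= a) (sym x) ->
  pairwise (fun a b => b <= a) (sym (x ++ [:: - M])).
Proof.
move=> bx M0 H; have -> : sym (x ++ [:: - M]) = M :: sym x ++ [:: - M].
  by rewrite /sym mir_cat mir1 opprK /= catA.
have bM : below M (sym x) by rewrite below_cat below_mir bx.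
rewrite /= pairwise_cat H all_cat allrel_consr allrel0r /= !andbT.
apply/andP; split; last by apply: sub_all bM => a; lia.
by apply/andP; split; [apply: sub_all bM => a; lia | lia].
Qed.

Section StepS.
Variables (r : seq int).
Hypothesis Hr : signed_perm r.
Local Notation M := (newval r).

Let M0 : 0 < M. Proof. by rewrite /newval. Qed.

Lemma below3 x y z : r = x ++ y ++ z -> [/\ below M x, below M y & below M z].
Proof. by move=> E; apply/and3P; rewrite -!below_cat -E; apply: signed_perm_below. Qed.

Lemma below_sym s : below M s -> below M (sym s).
Proof. by move=> bs; rewrite below_cat below_mir bs. Qed.

(** This lemma and the next three match the clauses of [surv] for sites of the parent: for each
    relative position of the new letter and the site, the condition that the letter adds to activity
    is the one by which [surv] is defined. *)
Lemma actP_max_right x y z : r = x ++ y ++ z ->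
  actP x (y ++ M :: z) = actP x (y ++ z) && allrel (fun a b => a <= b) y z.
Proof.
case/below3=> bx By bz; rewrite /actP no231_cat_max ?belowW //.
rewrite nostrad_catr_max ?belowW ?below_sym // !all_cat /= ?M0.
by andb_ac.
Qed.

Lemma actP_max_left x y z : r = x ++ y ++ z -> all (fun a => 0 < a) (y ++ z) ->
  actP (x ++ M :: y) z = actP (x ++ y) z && allrel (fun a b => b <= a) y z.
Proof.
case/below3=> bx By bz; rewrite all_cat => /andP[/allP py /allP pz]; rewrite /actP.
have -> : sym (x ++ M :: y) = (mir y ++ - M :: sym x) ++ M :: y.
  by rewrite /sym mir_cat mir_cons -!catA /= -?catA.
have bM : `|- M| < M + 1 by rewrite normrN gtr0_norm //; lia.
have BB s : below M s -> below (M + 1) s by exact: belowW.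
rewrite nostrad_catl_max //; last first.
  by rewrite below_cat /= bM !BB ?below_sym ?below_mir.
rewrite -catA /= nostrad_catl_min //; last by rewrite below_cat !BB ?below_sym.
have -> : allrel (fun a b => a <= b) (mir y) z.
  by apply/allrelP => a b; rewrite mem_mir => /py + /pz; lia.
by rewrite andbT /sym mir_cat -!catA !andbA.
Qed.

Lemma actN_max_right x y z : r = x ++ y ++ z -> all (fun a => 0 < a) z ->
  actN x (y ++ M :: z)
    = actN x (y ++ z) && allrel (fun a b => `|a| <= b) (x ++ y) z.
Proof.
move=> E; case/below3: (E) => bx By bz /allP pz; rewrite /actN.
have bM : `|- M| < M + 1 by rewrite normrN gtr0_norm //; lia.
have BB s : below M s -> below (M + 1) s by exact: belowW.
have bsy : below M (sym x ++ y) by rewrite (below_cat M (sym x) y) below_sym.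
have -> : mir (y ++ M :: z) = mir z ++ - M :: mir y by rewrite mir_cat mir_cons -catA.
rewrite (catA (sym x) y (M :: z)) (catA (sym x) y z).
rewrite no231_cat_max //; last exact: BB.
rewrite nostrad_catr_max; last first.
  by rewrite below_cat /= bM !BB ?below_mir.
rewrite nostrad_catl_min //; last 2 first.
- by rewrite BB ?below_mir.
- by rewrite (below_cat M (_ ++ y) z) bsy.
rewrite -mir_cat.
(* The condition created by [M] and the one created by its mirror [- M] combine into one bound on
   absolute values. *)
have -> : allrel (fun a b => `|a| <= b) (x ++ y) z =
    allrel (fun a b => a <= b) (sym x ++ y) z
    && allrel (fun a b => a <= b) (mir z) ((sym x ++ y) ++ z).
  apply/allrelP/andP => [H|[/allrelP H1 /allrelP H2] a b].
    split; apply/allrelP=> a b; rewrite !mem_cat mem_mir.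
      move=> /orP[/orP[ia|ia]|ia] bz'.
      - by have := H (- a) b; rewrite mem_cat ia => /(_ isT bz'); lia.
      - by have := H a b; rewrite mem_cat ia => /(_ isT bz'); lia.
      by have := H a b; rewrite mem_cat ia orbT => /(_ isT bz'); lia.
    rewrite mem_mir; move=> ia /orP[/orP[/orP[ib|ib]|ib]|/pz]; last by have := pz _ ia; lia.
    - by have := H (- b) (- a); rewrite mem_cat ib => /(_ isT ia); lia.
    - by have := H b (- a); rewrite mem_cat ib => /(_ isT ia); lia.
    by have := H b (- a); rewrite mem_cat ib orbT => /(_ isT ia); lia.
  move=> ia ib; have ia' : a \in (sym x ++ y).
    by move: ia; rewrite !mem_cat => /orP[] ->; rewrite !orbT.
  have := H1 _ _ ia' ib; have := H2 (- b) a.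
  by rewrite mem_mir opprK ib mem_cat ia' => /(_ isT isT); lia.
by andb_ac.
Qed.

Lemma actN_min_right x y z : r = x ++ y ++ z ->
  pairwise (fun a b => b <= a) (sym (x ++ y)) ->
  actN x (y ++ - M :: z)
    = actN x (y ++ z) && allrel (fun a b => a + b <= 0) y z.
Proof.
move=> E; case/below3: (E) => bx By bz; rewrite /sym mir_cat -!catA => desc.
rewrite /actN.
have BB s : below M s -> below (M + 1) s by exact: belowW.
have bM : `|M| < M + 1 by rewrite gtr0_norm //; lia.
have bsy : below M (sym x ++ y) by rewrite (below_cat M (sym x) y) below_sym.
have -> : mir (y ++ - M :: z) = mir z ++ M :: mir y.
  by rewrite mir_cat mir_cons opprK -catA.
rewrite (catA (sym x) y (- M :: z)) (catA (sym x) y z).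
rewrite no231_cat_min //; last exact: BB.
rewrite nostrad_catr_min; last by rewrite below_cat /= bM !BB ?below_mir.
rewrite nostrad_catl_max //; last 2 first.
- by rewrite BB ?below_mir.
- by rewrite (below_cat M (_ ++ y) z) bsy.
rewrite -mir_cat.
(* The decrease of [sym (x ++ y)] discharges the ascent condition of [no231_cat_min], and leaves
   only the comparison with [z] in the condition of [nostrad_catl_max]. *)
move: desc; rewrite pairwise_cat !catA -/(sym x) => /and3P[/allrelP H _ ->].
have -> : allrel (fun a b => b <= a) (mir y) ((sym x ++ y) ++ z)
   = allrel (fun a b => a + b <= 0) y z.
  apply/allrelP/allrelP => H' a b ia ib.
    have := H' (- a) b; rewrite mem_mir opprK mem_cat ib orbT => /(_ ia isT).
    by lia.
  move: ib; rewrite mem_cat => /orP[/(H _ _ ia)//|ib].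
  by rewrite mem_mir in ia; have := H' _ _ ia ib; lia.
by andb_ac.
Qed.

End StepS.

End Activity.

(** * The step law for signed permutations *)

Section StepSymmetric.
Implicit Types (r s t x y z : seq int) (v w a b : int).

Lemma newval_gt0 r : 0 < newval r. Proof. by []. Qed.

Lemma actN_max_false M x y z : 0 < M -> actN (x ++ M :: y) z = false.
Proof. by move=> M0; rewrite /actN sym_desc_max_false. Qed.

Lemma step_actS_pos r (k : nat) : signed_perm r -> (k <= size r)%N -> actS r k ->
  [/\ actS (child r k) k && actS (child r k) k.+1,
      forall w, in_range (size r).+1 w -> w < k ->
        actS (child r k) w = actS r w && surv r k w
    & forall w, in_range (size r) w -> k%:Z < w ->
        actS (child r k) (shift w) = actS r w && surv r k w].
Proof.
move=> Hr rk; have M0 := newval_gt0 r.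
have [X [Y [E sk]]] : exists x y, r = x ++ y /\ k = size x by apply: split_seq; lia.
have r'E : child r k = X ++ newval r :: Y by have := child_pos X Y; rewrite -E sk.
rewrite (actS_pos E sk) => aXY; have pY : all (fun a => 0 < a) Y by case/and3P: aXY.
have U (j : nat) : (k <= j <= size r)%N ->
    actS (child r k) j.+1 = actS r j && surv r k j.
  move=> kj; have [x [y [z [E' sx sj]]]] : exists x y z,
    [/\ r = x ++ y ++ z, k = size x & j = (size x + size y)%N] by apply: split_seq2; lia.
  have r'E' : child r k = (x ++ newval r :: y) ++ z.
    by have := child_pos x (y ++ z); rewrite -E' sx -catA.
  have YE : Y = y ++ z.
    by move/eqP: E; rewrite E' eqseq_cat -?sk // => /andP[_ /eqP].
  rewrite (@surv_pos_gt _ x y z) // (@actS_pos r (x ++ y) z); [|solve_sizes..].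
  rewrite (@actS_pos _ (x ++ newval r :: y) z); [|solve_sizes..].
  by rewrite actP_max_left // -YE.
split=> //.
- rewrite (U k) ?surv_self ?(actS_pos E sk) ?aXY; last by lia.
  rewrite (actS_pos r'E sk) /= !andbT.
  by rewrite (@actP_max_right r Hr X [::] Y) // aXY allrel0l.
- move=> [j|j] jr jk.
    have [x [y [z [E' sx sj]]]] : exists x y z,
      [/\ r = x ++ y ++ z, j = size x & k = (size x + size y)%N] by apply: split_seq2; lia.
    have r'E' : child r k = x ++ (y ++ newval r :: z).
      by have := child_pos (x ++ y) z; rewrite -!catA -E' => <-; rewrite sj size_cat.
    rewrite (@surv_pos_lt _ x y z) // (@actS_pos r x (y ++ z)); [|solve_sizes..].
    rewrite (@actS_pos _ x (y ++ newval r :: z)); [|solve_sizes..].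
    exact: actP_max_right.
  (* If [k < j], the prefix before the site contains the new maximum. Its symmetrization then has
     the ascent from [- newval r] to [newval r], and the site is dead. *)
  case: (leqP j k) => kj; last first.
    have [x [y [YE sj]]] : exists x y, Y = x ++ y /\ (j - k.+1)%N = size x.
      by apply: split_seq; move: jr; rewrite /in_range E size_cat; lia.
    rewrite (@actS_neg _ (X ++ newval r :: x) y); last 2 first.
    - by rewrite r'E YE -catA.
    - by rewrite size_cat /=; lia.
    by rewrite actN_max_false // /surv (leqNgt j k) kj andbF.
  have [x [y [XE sj]]] : exists x y, X = x ++ y /\ j = size x by apply: split_seq; lia.
  have E' : r = x ++ y ++ Y by rewrite E XE -catA.
  rewrite (@actS_neg _ x (y ++ newval r :: Y)) //; last by rewrite r'E XE -catA.
  rewrite (actS_neg E' sj) (@surv_pos_neg r X Y) // kj (actN_max_right Hr E') //.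
  by rewrite XE.
move=> [j|j]; last by lia.
by move=> /andP[_ jr] kj; rewrite shift_pos U //; lia.
Qed.

Lemma step_actS_neg r (k : nat) : signed_perm r -> (k <= size r)%N ->
  actS r (Negz k) ->
  [/\ pairwise (fun a b => b <= a) (sym (take k r)),
      actS (child r (Negz k)) (Negz k.+1) && actS (child r (Negz k)) (Negz k),
      actS (child r (Negz k)) 0 = false,
      forall w, in_range (size r).+1 w -> w < Negz k.+1 ->
        actS (child r (Negz k)) w = actS r w && surv r (Negz k) w
    & forall w, in_range (size r) w -> Negz k < w ->
        actS (child r (Negz k)) (shift w) = actS r w && surv r (Negz k) w].
Proof.
move=> Hr rk; have M0 := newval_gt0 r.
have [X [Y [E sk]]] : exists x y, r = x ++ y /\ k = size x by apply: split_seq; lia.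
have r'E : child r (Negz k) = X ++ - newval r :: Y.
  by have := child_neg X Y; rewrite -E sk.
have tE : take k r = X by rewrite E sk take_size_cat.
have /andP[bX bY] : below (newval r) X && below (newval r) Y.
  by rewrite -below_cat -E; apply: signed_perm_below.
rewrite (actS_neg E sk) => aXY.
have desc : pairwise (fun a b => b <= a) (sym X) by case/and3P: aXY.
split; first by rewrite tE.
- rewrite (actS_neg r'E sk) (@actN_min_right r Hr X [::] Y) //; last by rewrite cats0.
  rewrite aXY allrel0l !andbT.
  rewrite (@actS_neg _ (X ++ [:: - newval r]) Y); last 2 first.
  - by rewrite r'E -catA.
  - by rewrite size_cat /=; lia.
  rewrite /actN sym_desc_min //.
  have -> : sym (X ++ [:: - newval r]) ++ Y = newval r :: sym X ++ - newval r :: Y.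
    by rewrite /sym mir_cat mir1 opprK -!catA.
  have bM : `|- newval r| < newval r + 1 by rewrite normrN gtr0_norm //; lia.
  have bsX : below (newval r) (sym X) by rewrite below_cat below_mir bX.
  rewrite (no231_cat_max (s := [::])) //; last first.
    by rewrite (below_cat _ (sym X)) /= bM !belowW.
  rewrite allrel0l andbT (no231_cat_min (s := sym X)) ?belowW // desc andbT.
  rewrite (nostrad_catr_max [::]) ?belowW ?below_mir //=.
  by rewrite nostrad_catr_min ?belowW ?below_mir //; case/and3P: aXY => _ -> ->.
- rewrite (@actS_pos _ [::] (X ++ - newval r :: Y)) // /actP all_cat /=.
  by apply/negP; rewrite -andbA => /and3P[]; lia.
- move=> [j|j] jr kj; first by lia.
  rewrite /surv; have -> : (j < k)%N = false by lia.
  rewrite andbF.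
  have [x [y [YE sj]]] : exists x y, Y = x ++ y /\ (j - k.+1)%N = size x.
    by apply: split_seq; move: jr; rewrite /in_range E size_cat; lia.
  (* As [j > k + 1], some letter [c] follows [- newval r] before the site, and these two letters
     form an ascent of the prefix. *)
  case: x YE sj => [|c x] YE sj; first by rewrite /= in sj; lia.
  rewrite (@actS_neg _ (X ++ - newval r :: c :: x) y); last 2 first.
  - by rewrite r'E YE -catA.
  - by move: sj; rewrite size_cat /=; lia.
  rewrite /actN /sym pairwise_cat pairwise_cat /=.
  have : - newval r < c by have := below_lt bY (_ : c \in Y); rewrite YE inE eqxx => /(_ isT); lia.
  by case: (lerP c (- newval r)) => //=; rewrite ?andbF.
move=> [j|j] jr kj.
  rewrite shift_pos; have [jk|jk] := ltnP j k.
    have [x [y [XE sj]]] : exists x y, X = x ++ y /\ j.+1 = size x by apply: split_seq; lia.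
    rewrite (@actS_pos _ x (y ++ - newval r :: Y)) //; last by rewrite r'E XE -catA.
    rewrite /surv; have -> : (j == size r) = false by lia.
    rewrite andbF /actP all_cat /=.
    by apply/negP; rewrite -andbA => /and3P[]; lia.
  have [y [z [YE sj]]] : exists x y, Y = x ++ y /\ (j - k)%N = size x.
    by apply: split_seq; move: jr; rewrite /in_range E size_cat; lia.
  have E' : r = (X ++ y) ++ z by rewrite E YE catA.
  rewrite (@actS_pos _ (X ++ - newval r :: y) z); last 2 first.
  - by rewrite r'E YE -catA.
  - by rewrite size_cat /=; lia.
  rewrite (@actS_pos _ (X ++ y) z) //; last by rewrite size_cat; lia.
  have szr : size r = (size X + size y + size z)%N by rewrite {1}E' !size_cat.
  have -> : surv r (Negz k) j = (size z == 0)%N by rewrite /surv; lia.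
  (* With no letter after it, the site is the rightmost one, active before and after. Otherwise the
     next letter [c] is straddled by the descent from the mirror letter [newval r] to
     [- newval r]. *)
  case: z E' YE szr => [|c z] E' YE szr; first by rewrite /actP !nostrad_nil.
  rewrite andbF /actP; apply/negP=> /and3P[_ _].
  have -> : sym (X ++ - newval r :: y) = mir y ++ newval r :: (sym X ++ - newval r :: y).
    by rewrite /sym mir_cat mir_cons opprK -!catA /= -?catA.
  rewrite /nostrad pairwise_cat => /and3P[_ _] /= /andP[+ _].
  rewrite all_cat /= => /and3P[_ + _] => /andP[+ _].
  by have := below_lt bY (_ : c \in Y); rewrite YE mem_cat inE eqxx orbT => /(_ isT); lia.
have -> : shift (Negz j) = Negz j by [].
have jk : (j < k)%N by lia.
have [x [y [XE sj]]] : exists x y, X = x ++ y /\ j = size x by apply: split_seq; lia.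
have E' : r = x ++ y ++ Y by rewrite E XE -catA.
rewrite (@actS_neg _ x (y ++ - newval r :: Y)) //; last by rewrite r'E XE -catA.
rewrite (actS_neg E' sj) (@surv_neg r x y Y k j) //; last by rewrite sk XE size_cat.
by apply: actN_min_right => //; rewrite -XE.
Qed.

Lemma step_actS : step_law actS.
Proof.
move=> r [k|k] Hr rv av.
  have [|H1 H2 H3] := step_actS_pos Hr _ av; first by move: rv; rewrite /in_range; lia.
  by rewrite upper_pos; split.
have [|H1 H2 H3 H4 H5] := step_actS_neg Hr _ av; first by move: rv; rewrite /in_range; lia.
by rewrite lower_neg; split.
Qed.

End StepSymmetric.

(** * Isomorphism of the generating trees *)

Section Bisimulation.
Implicit Types (r s q : seq int) (v w a b : int) (act : seq int -> int -> bool).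

Definition all_sites n : seq int :=
  [seq k%:Z - n.+1%:Z | k <- iota 0 (n.+1).*2].

Definition sites act r : seq int := filter (act r) (all_sites (size r)).

Lemma mem_all_sites n v : (v \in all_sites n) = in_range n v.
Proof.
apply/mapP/idP => [[k]|]; first by rewrite mem_iota /in_range => ? ->; lia.
rewrite /in_range => rv; exists (absz (v + n.+1%:Z)); last by lia.
by rewrite mem_iota; lia.
Qed.

Lemma all_sites_sorted n : sorted <%R (all_sites n).
Proof.
rewrite sorted_map; apply: sub_sorted (iota_ltn_sorted 0 _) => i j /=.
by rewrite ltrD2r ltz_nat.
Qed.

Lemma sites_sorted act r : sorted <%R (sites act r).
Proof. by apply: sorted_filter (all_sites_sorted _) => ???; apply: lt_trans. Qed.

Lemma lt_filter_sorted (p : pred int) s : sorted <%R s -> sorted <%R (filter p s).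
Proof. by apply: sorted_filter => ???; apply: lt_trans. Qed.

Lemma mem_sites act r v : (v \in sites act r) = act r v && in_range (size r) v.
Proof. by rewrite mem_filter mem_all_sites. Qed.

Lemma surv_lt r v w : surv r v w -> w < v -> 0 <= v.
Proof. by case: v => // i; case: w => j //= /andP[]; lia. Qed.

Lemma shift_range n w : in_range n w -> in_range n.+1 (shift w).
Proof. by rewrite /shift /in_range; case: ifP; lia. Qed.

Lemma shift_homo : {mono shift : v w / v < w}.
Proof. by move=> v w; rewrite /shift; do 2 case: ifP; lia. Qed.

Lemma lower_upper v : lower v < upper v.
Proof. by rewrite /lower /upper; case: ifP; lia. Qed.

Lemma lower_shift v w : v <= w -> lower v < shift w.
Proof. by rewrite /lower /shift; do 2 case: ifP; lia. Qed.

Lemma upper_shift v w : v < w -> upper v < shift w.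
Proof. by rewrite /upper /shift; do 2 case: ifP; lia. Qed.

Lemma lt_lower v w : w < lower v -> w < v.
Proof. by rewrite /lower; case: ifP; lia. Qed.

Lemma ge_lower v w : lower v < w -> (w < v) = false.
Proof. by rewrite /lower; case: ifP; lia. Qed.

Lemma gt_upper v w : lower v < w -> w != upper v -> upper v < w.
Proof. by rewrite /lower /upper; case: ifP; lia. Qed.

Lemma lower_range n v : in_range n v -> in_range n.+1 (lower v).
Proof. by rewrite /lower /in_range; case: ifP; lia. Qed.

Lemma upper_range n v : in_range n v -> in_range n.+1 (upper v).
Proof. by rewrite /upper /in_range; case: ifP; lia. Qed.

Lemma surv_range r v w : in_range (size r) v -> surv r v w -> w < v ->
  in_range (size r) w.
Proof.
move=> + sw wv; have := surv_lt sw wv.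
by case: v sw wv => // i sw wi _; rewrite /in_range; case: w sw wi => j /=; lia.
Qed.

Lemma shift_onto n v w : in_range n v -> upper v < w -> in_range n.+1 w -> ~ (v < 0 /\ w = 0) ->
  exists u, [/\ w = shift u, v < u & in_range n u].
Proof.
rewrite /upper /in_range => rv vw rw nv.
have [w0|w0] := ltP 0 w.
  exists (w - 1); have -> : shift (w - 1) = w by rewrite /shift; case: ifP; lia.
  by move: vw; case: ifP => ? ?; split; lia.
exists w; have -> : shift w = w by rewrite /shift; move: vw; do 2 case: ifP; lia.
by move: vw; case: ifP => ? ?; split; lia.
Qed.

(** Both sides are strictly increasing, so it suffices that they have the same members. A left
    survivor forces [0 <= v], hence [lower v = v], and so comes before [lower v]. *)
Lemma sites_child act r v : step_law act -> signed_perm r -> v \in sites act r ->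
  sites act (child r v) =
    [seq w <- sites act r | (w < v) && surv r v w]
    ++ lower v :: upper v ::
    [seq shift w | w <- [seq w <- sites act r | (v < w) && surv r v w]].
Proof.
move=> law Hr; rewrite mem_sites => /andP[av rv].
have [_ /andP[al au] a0 alo aup] := law _ _ Hr rv av.
have vl := lower_upper v; have rl := lower_range rv; have ru := upper_range rv.
have srtU : sorted <%R [seq shift w | w <- [seq w <- sites act r | (v < w) && surv r v w]].
  rewrite sorted_map; apply: sub_sorted (lt_filter_sorted _ (sites_sorted act r)).
  by move=> a b ab; rewrite /= shift_homo.
apply: lt_sorted_eq; first exact: sites_sorted.
  rewrite lt_sorted_pairwise pairwise_cat -!lt_sorted_pairwise.
  rewrite (lt_filter_sorted _ (sites_sorted act r)) /= vl /=.
  rewrite path_sortedE; last exact: lt_trans.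
  rewrite srtU andbT; apply/andP; split.
    apply/allrelP=> a b; rewrite mem_filter => /andP[/andP[ltav sa] _].
    have al' : a < lower v by rewrite /lower (surv_lt sa).
    rewrite !inE => /orP[/eqP->//|/orP[/eqP->|]]; first exact: lt_trans vl.
    case/mapP=> w; rewrite mem_filter => /andP[/andP[vw _] _] ->.
    by apply: lt_trans al' _; apply: lower_shift (ltW vw).
  apply/allP=> b /mapP[w]; rewrite mem_filter => /andP[/andP[vw _] _] ->.
  exact: upper_shift.
move=> w; rewrite mem_sites size_child mem_cat !inE mem_filter mem_sites.
have [->|wl] := eqVneq w (lower v); first by rewrite al rl orbT.
have [->|wu] := eqVneq w (upper v); first by rewrite au ru orbT.
rewrite /=; have [wv|vw|/eqP] := ltgtP w (lower v); last by rewrite (negPf wl).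
  have -> : w \in [seq shift w | w <- [seq w <- sites act r | (v < w) && surv r v w]] = false.
    apply/negP=> /mapP[u]; rewrite mem_filter => /andP[/andP[vu _] _] wE.
    by have := lt_trans wv (lower_shift (ltW vu)); rewrite wE ltxx.
  have wv' := lt_lower wv; rewrite orbF wv' /=.
  have [sw|nsw] := boolP (surv r v w); last first.
    case rw: (in_range (size r).+1 w); last by rewrite andbF.
    by rewrite alo // (negPf nsw) andbF.
  have rw := surv_range rv sw wv'; rewrite rw.
  have rw' : in_range (size r).+1 w by move: rw; rewrite /in_range; clear; lia.
  by rewrite alo // sw rw' !andbT.
rewrite (ge_lower vw) /=; have vw' := gt_upper vw wu.
apply/andP/mapP => [[aw rw]|[u]].
  (* The exception in [shift_onto] is the site 0 of the child for negative [v], which is inactive by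
     the step law. *)
  have [|u [wE vu ru']] := shift_onto rv vw' rw.
    by case=> v0 w0; move: aw; rewrite w0 a0.
  exists u => //; rewrite mem_filter vu mem_sites ru' andbT /=.
  by rewrite andbC -aup // -wE.
rewrite mem_filter mem_sites => /andP[/andP[vu su] /andP[au' ru']] ->.
by rewrite aup // su au' shift_range.
Qed.

Lemma surv_top r v : in_range (size r) v -> surv r v (size r).
Proof.
case: v => k rk; rewrite /surv //.
have -> : (size r < k)%N = false by move: rk; rewrite /in_range; lia.
by rewrite [X in allrel _ _ X]drop_size allrel0r.
Qed.

(** As site lists increase, [z] is the order isomorphism between them. The rightmost sites must
    correspond explicitly, because the relation [surv] of a child depends on which site is
    rightmost. The last clause, with both directions, covers all pairs of distinct sites. *)
Definition matched act1 act2 r q : Prop := exists z : seq (int * int),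
  [/\ sites act1 r = unzip1 z, sites act2 q = unzip2 z,
      ((size r)%:Z, (size q)%:Z) \in z
    & {in z &, forall p p', p.1 < p'.1 ->
        surv r p.1 p'.1 = surv q p.2 p'.2 /\ surv r p'.1 p.1 = surv q p'.2 p.2}].

Lemma sorted_zip_lt (z : seq (int * int)) : sorted <%R (unzip1 z) ->
  sorted <%R (unzip2 z) -> {in z &, forall p p', (p.1 < p'.1) = (p.2 < p'.2)}.
Proof.
rewrite !lt_sorted_pairwise !pairwise_map => s1 s2.
elim: z s1 s2 => // p z IH /= /andP[/allP s1 S1] /andP[/allP s2 S2] a b.
rewrite !inE => /orP[/eqP->|az] /orP[/eqP->|bz]; rewrite ?ltxx //.
- by rewrite [LHS]s1 // [RHS]s2.
- by rewrite !ltNge (ltW (s1 _ az)) (ltW (s2 _ az)).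
exact: IH.
Qed.

Lemma matched_child act1 act2 r q v w (z : seq (int * int)) :
  step_law act1 -> step_law act2 ->
  signed_perm r -> signed_perm q ->
  sites act1 r = unzip1 z -> sites act2 q = unzip2 z ->
  ((size r)%:Z, (size q)%:Z) \in z ->
  {in z &, forall p p', p.1 < p'.1 ->
    surv r p.1 p'.1 = surv q p.2 p'.2 /\ surv r p'.1 p.1 = surv q p'.2 p.2} ->
  (v, w) \in z -> matched act1 act2 (child r v) (child q w).
Proof.
move=> law1 law2 Hr Hq E1 E2 top K vz.
have zlt : {in z &, forall p p', (p.1 < p'.1) = (p.2 < p'.2)}.
  by apply: sorted_zip_lt; rewrite -?E1 -?E2; apply: sites_sorted.
have zeq : {in z &, forall p p', (p.1 == p'.1) = (p.2 == p'.2)}.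
  move=> p p' pz pz'; have := zlt _ _ pz pz'; have := zlt _ _ pz' pz.
  by case: (ltgtP p.1); case: (ltgtP p.2).
have in1 p : p \in z -> p.1 \in sites act1 r by rewrite E1; apply: map_f.
have in2 p : p \in z -> p.2 \in sites act2 q by rewrite E2; apply: map_f.
have rg1 p : p \in z -> in_range (size r) p.1 by move/in1; rewrite mem_sites => /andP[].
have rg2 p : p \in z -> in_range (size q) p.2 by move/in2; rewrite mem_sites => /andP[].
have ok1 : descending_if_neg r v.
  by have := in1 _ vz; rewrite mem_sites => /andP[? /law1[]].
have ok2 : descending_if_neg q w.
  by have := in2 _ vz; rewrite mem_sites => /andP[? /law2[]].
have Kv p : p \in z -> (p.1 < v) && surv r v p.1 = (p.2 < w) && surv q w p.2.
  move=> pz; have := zlt _ _ pz vz; rewrite /= => <-.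
  by case pv: (p.1 < v) => //=; have [] := K _ _ pz vz pv.
have Kv' p : p \in z -> (v < p.1) && surv r v p.1 = (w < p.2) && surv q w p.2.
  move=> pz; have := zlt _ _ vz pz; rewrite /= => <-.
  by case pv: (v < p.1) => //=; have [] := K _ _ vz pz pv.
exists ([seq p <- z | (p.1 < v) && surv r v p.1]
  ++ (lower v, lower w) :: (upper v, upper w) ::
  [seq (shift p.1, shift p.2) | p <- [seq p <- z | (v < p.1) && surv r v p.1]]).
have top' p : p \in z ->
    (shift p.1 == (size r).+1) = (shift p.2 == (size q).+1).
  move=> pz; have := zeq _ _ pz top; rewrite /=.
  have aux (a : int) (n : nat) : (shift a == n.+1) = (a == n).
    by rewrite /shift; case: ifP; lia.
  by rewrite !aux.
split.
- rewrite (sites_child law1 Hr (in1 _ vz)) /unzip1 map_cat /= E1.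
  by rewrite /unzip1 !filter_map -!map_comp.
- rewrite (sites_child law2 Hq (in2 _ vz)) /unzip2 map_cat /= E2.
  rewrite /unzip2 !filter_map -!map_comp.
  congr (_ ++ _ :: _ :: _).
    by congr map; apply: eq_in_filter => p pz; rewrite /= Kv.
  by congr map; apply: eq_in_filter => p pz; rewrite /= Kv'.
- rewrite !size_child mem_cat !inE; apply/orP; right; apply/orP; right.
  have := zeq _ _ top vz; rewrite /=; case: eqP => [rv|/eqP rv] /esym.
    by move/eqP=> qw; rewrite -rv -qw !upper_pos eqxx.
  move=> _; apply/orP; right; apply/mapP.
  exists ((size r)%:Z, (size q)%:Z); last by rewrite !shift_pos.
  rewrite mem_filter top andbT /= surv_top ?(rg1 _ vz) // andbT.
  by have := rg1 _ vz; move: rv; rewrite /in_range /=; lia.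
(* The class [isB] gathers the upper halves and the right survivors, the former being the shifts of
   [v] and [w] themselves. *)
pose isB p := exists p0, [/\ p0 \in z, v <= p0.1 /\ w <= p0.2,
  (p0.1 == v) || surv r v p0.1, (p0.2 == w) || surv q w p0.2 &
  p = (shift p0.1, shift p0.2)].
have memP p : p \in [seq p <- z | (p.1 < v) && surv r v p.1]
  ++ (lower v, lower w) :: (upper v, upper w) ::
  [seq (shift p.1, shift p.2) | p <- [seq p <- z | (v < p.1) && surv r v p.1]] ->
  [\/ [/\ p \in z, p.1 < v, surv r v p.1, p.2 < w & surv q w p.2],
      p = (lower v, lower w) | isB p].
  rewrite mem_cat !inE mem_filter => /orP[/andP[Ha pz]|].
    move: (Ha); rewrite Kv // => /andP[? ?]; case/andP: Ha => ? ?.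
    exact: Or31.
  move=> /or3P[/eqP->|/eqP->|]; first exact: Or32.
    apply: Or33; exists (v, w); split=> //=; rewrite ?eqxx //.
  case/mapP=> p0; rewrite mem_filter => /andP[Ha pz] ->.
  move: (Ha); rewrite Kv' // => /andP[wp sq]; case/andP: Ha => vp sp.
  apply: Or33; exists p0.
  by split; rewrite ?sp ?sq ?orbT //; split; apply: ltW.
(* A survivor on the left forces a nonnegative insertion site; this excludes the cases below in
   which the two sites come in the wrong order. *)
have lowN b a : surv r b a -> a < b -> lower b = b by move=> sa ab; rewrite /lower (surv_lt sa).
(* Nine cases: each site is a left survivor, the lower half, or in [isB]. The cases in the right
   order are settled by the lemmas on children, applied in both trees. *)
move=> a b /memP[] Ha /memP[] Hb.
- case: Ha Hb => az av sa aw sa' [bz bv sb bw sb'] ab.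
  have ab' : a.2 < b.2 by rewrite -zlt.
  have [-> ->] := surv_child_lo Hr (rg1 _ vz) ok1 ab bv (rg1 _ az) sa sb.
  have [-> ->] := surv_child_lo Hq (rg2 _ vz) ok2 ab' bw (rg2 _ az) sa' sb'.
  by have [_ ->] := K _ _ az bz ab.
- case: Ha => az av sa aw sa' _; rewrite Hb /=.
  have [-> ->] := surv_child_lower Hr (rg1 _ vz) ok1 av sa.
  by have [-> ->] := surv_child_lower Hq (rg2 _ vz) ok2 aw sa'.
- case: Ha => az av sa aw sa' _; case: Hb => p [pz [vp wp] sp sp' -> /=].
  have [-> ->] := surv_child_shift Hr (rg1 _ vz) ok1 av sa vp sp (rg1 _ pz).
  have [-> ->] := surv_child_shift Hq (rg2 _ vz) ok2 aw sa' wp sp' (rg2 _ pz).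
  by rewrite top'.
- case: Hb => bz bv sb _ _; by rewrite Ha /= (lowN _ _ sb bv) ltNge (ltW bv).
- by rewrite Ha Hb ltxx.
- move=> _; case: Hb => p [pz [vp wp] sp sp' ->]; rewrite Ha /=.
  have [-> ->] := surv_lower_shift Hr (rg1 _ vz) ok1 vp sp (rg1 _ pz).
  have [-> ->] := surv_lower_shift Hq (rg2 _ vz) ok2 wp sp' (rg2 _ pz).
  by rewrite top'.
- case: Ha => p [_ [vp _] _ _ ->] /=; case: Hb => bz bv sb _ _.
  have := lower_shift vp; rewrite (lowN _ _ sb bv) => /(lt_trans bv)/ltW.
  by rewrite ltNge => ->.
- by case: Ha => p [_ [vp _] _ _ ->] /=; rewrite Hb /= ltNge (ltW (lower_shift vp)).
case: Ha => p [pz [vp wp] sp sp' ->] /=; case: Hb => p' [p'z [vp' wp'] tp tp' ->] /=.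
rewrite shift_homo => pp; have pp' : p.2 < p'.2 by rewrite -zlt.
have {}tp : surv r v p'.1.
  by case/orP: tp => // /eqP E; move: pp; rewrite E ltNge vp.
have {}tp' : surv q w p'.2.
  by case/orP: tp' => // /eqP E; move: pp'; rewrite E ltNge wp.
have [-> ->] := surv_shift Hr (rg1 _ vz) ok1 vp pp sp tp (rg1 _ p'z).
have [-> ->] := surv_shift Hq (rg2 _ vz) ok2 wp pp' sp' tp' (rg2 _ p'z).
by rewrite top'.
Qed.

End Bisimulation.

(** * Levels of the generating trees *)

Section Levels.
Implicit Types (r s q : seq int) (v w a b : int) (act : seq int -> int -> bool).

Fixpoint level act r0 n : seq (seq int) :=
  if n is n'.+1 then [seq child r v | r <- level act r0 n', v <- sites act r]
  else [:: r0].

Fixpoint descendants act n r : nat :=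
  if n is n'.+1 then sumn [seq descendants act n' (child r v) | v <- sites act r]
  else 1.

(** [level] grows at the leaves, whereas [descendants] recurses from the root; the induction moves
    one generation at a time from the first to the second. *)
Lemma sumn_level act r0 n m :
  sumn [seq descendants act m r | r <- level act r0 n] = descendants act (n + m) r0.
Proof.
elim: n m => [|n IH] m; first by rewrite /= addn0.
rewrite addSnnS -IH map_flatten sumn_flatten -!map_comp; congr sumn.
by apply: eq_map => r /=; rewrite -map_comp.
Qed.

Lemma size_level act r0 n : size (level act r0 n) = descendants act n r0.
Proof.
rewrite -[n in RHS]addn0 -sumn_level.
by elim: (level act r0 n) => //= r s ->.
Qed.

Lemma iota1_rcons n : iota 1 n.+1 = rcons (iota 1 n) n.+1.
Proof. by rewrite -cats1 -[[:: n.+1]]/(iota (1 + n) 1) -iotaD addn1. Qed.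

Lemma signed_perm_child r v : signed_perm r -> in_range (size r) v ->
  signed_perm (child r v).
Proof.
move=> Hr rv; rewrite /signed_perm size_child.
rewrite iota1_rcons.
have P (c : int) k : absz c = (size r).+1 ->
    perm_eq (map absz (take k r ++ c :: drop k r)) (rcons (iota 1 (size r)) (size r).+1).
  move=> cE; rewrite map_cat /= cE -cat1s perm_catCA cat1s perm_sym perm_rcons perm_cons.
  by rewrite -map_cat cat_take_drop perm_sym.
by case: v rv => k _; apply: P; rewrite /newval ?abszN.
Qed.

Lemma child_surj n s : signed_perm s -> size s = n.+1 ->
  exists r v, [/\ signed_perm r, size r = n, in_range n v & s = child r v].
Proof.
move=> Hs sn; have : n.+1 \in map absz s by rewrite (perm_mem Hs) mem_iota sn; lia.
case/mapP=> c cs cE; case/splitPr: cs Hs sn => x y Hs sn.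
have szr : size (x ++ y) = n by move: sn; rewrite !size_cat /= addnS => -[].
have Hr : signed_perm (x ++ y).
  move: Hs; rewrite /signed_perm sn szr iota1_rcons.
  rewrite map_cat /= -cat1s perm_catCA cat1s -cE perm_sym perm_rcons perm_cons perm_sym.
  by rewrite -map_cat.
have xn : (size x <= n)%N by rewrite -szr size_cat leq_addr.
have [c0|c0] := leP 0 c.
  exists (x ++ y), (size x); split; rewrite ?child_pos /newval ?szr //.
  by congr (_ ++ _ :: _); lia.
exists (x ++ y), (Negz (size x)); split; rewrite ?child_neg /newval ?szr //.
  by rewrite /in_range; move: (size x) xn => k; lia.
by congr (_ ++ _ :: _); lia.
Qed.

(** [parent] and [last_site] invert [child], so that no word occurs twice in a level. *)
Definition parent s : seq int := filter (fun a => `|a| < size s) s.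

Definition last_site s : int :=
  if (size s)%:Z \in s then (index (size s)%:Z s)%:Z
  else Negz (index (- (size s)%:Z) s).

Lemma parent_child r v : signed_perm r -> parent (child r v) = r.
Proof.
move=> Hr; rewrite /parent size_child.
have H : filter (fun a => `|a| < (size r).+1) r = r.
  by apply/all_filterP/(signed_perm_below Hr).
by case: v => k; rewrite /child filter_cat /= ?normrN /newval ltxx -filter_cat
  cat_take_drop.
Qed.

Lemma last_site_child r v : signed_perm r -> in_range (size r) v ->
  last_site (child r v) = v.
Proof.
move=> Hr rv; rewrite /last_site size_child; have bel := signed_perm_below Hr.
have inr a k : a \in take k r ++ drop k r -> `|a| < newval r.
  by rewrite cat_take_drop => /(allP bel).
have nin (a : int) k : `|a| = newval r -> a \notin take k r ++ drop k r.
  by move=> aE; apply/negP=> /inr; rewrite aE ltxx.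
have N1 k : newval r \notin take k r ++ drop k r by apply: nin.
have N2 k : - newval r \notin take k r ++ drop k r by apply: nin; rewrite normrN.
case: v rv => k; rewrite /in_range => rk.
  have := N1 k; rewrite mem_cat negb_or => /andP[/negPf n1 _].
  rewrite /child mem_cat inE eqxx orbT index_cat n1 /= eqxx addn0 size_takel //.
have := N1 k; rewrite mem_cat negb_or => /andP[/negPf n1 /negPf n2].
have := N2 k; rewrite mem_cat negb_or => /andP[/negPf n3 _].
have n4 : (newval r == - newval r) = false by [].
rewrite /child mem_cat inE n1 n2 n4 /=.
by rewrite index_cat n3 /= eqxx addn0 size_takel //; lia.
Qed.

Definition extension_law act (good : seq int -> Prop) : Prop := forall r v,
  signed_perm r -> in_range (size r) v ->
  good (child r v) <-> good r /\ act r v.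

Lemma mem_level act good r0 : extension_law act good ->
  (forall s, s = r0 <-> [/\ signed_perm s, size s = size r0 & good s]) ->
  forall n s, s \in level act r0 n <->
    [/\ signed_perm s, size s = (size r0 + n)%N & good s].
Proof.
move=> ext base; elim=> [|n IH] s.
  by rewrite addn0 /= inE -base; split=> [/eqP|->].
split=> [/allpairsPdep[r [v [/IH[Hr sr gr] + ->]]]|[Hs ss gs]].
  rewrite mem_sites => /andP[av rv]; split; first exact: signed_perm_child.
    by rewrite size_child sr addnS.
  exact/ext.
rewrite addnS in ss; have [r [v [Hr sr rv sE]]] := child_surj Hs ss.
rewrite -sr in rv; move: gs; rewrite sE => /(ext _ _ Hr rv)[gr av].
apply/allpairsPdep; exists r, v; split=> //; first by apply/IH.
by rewrite mem_sites av.
Qed.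

Lemma level_uniq act good r0 : extension_law act good ->
  (forall s, s = r0 <-> [/\ signed_perm s, size s = size r0 & good s]) ->
  forall n, uniq (level act r0 n).
Proof.
move=> ext base; elim=> //= n IH; apply: allpairs_uniq_dep => //.
  by move=> r _; apply: lt_sorted_uniq (sites_sorted act r).
move=> p p' /allpairsPdep[r [v [/(mem_level ext base)[Hr _ _] rv ->]]].
case/allpairsPdep=> r' [v' [/(mem_level ext base)[Hr' _ _] rv' ->]] /= E.
move: rv rv'; rewrite !mem_sites => /andP[_ rv] /andP[_ rv'].
have rE : r = r' by rewrite -(parent_child v Hr) E parent_child.
by rewrite -rE in rv' E *; rewrite -(last_site_child Hr rv) E last_site_child.
Qed.

Lemma matched_descendants act1 act2 : step_law act1 -> step_law act2 ->
  forall n r q, signed_perm r -> signed_perm q -> matched act1 act2 r q ->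
  descendants act1 n r = descendants act2 n q.
Proof.
move=> law1 law2; elim=> //= n IH r q Hr Hq [z [E1 E2 top K]].
rewrite E1 E2 -!map_comp; congr sumn; apply/eq_in_map=> p pz /=.
have r1 : in_range (size r) p.1.
  by have : p.1 \in sites act1 r by [rewrite E1; apply: map_f];
    rewrite mem_sites => /andP[].
have r2 : in_range (size q) p.2.
  by have : p.2 \in sites act2 q by [rewrite E2; apply: map_f];
    rewrite mem_sites => /andP[].
apply: IH; try exact: signed_perm_child.
by apply: (matched_child law1 law2 Hr Hq E1 E2 top K); case: p pz {r1 r2}.
Qed.

Lemma matched_roots : matched actA actS [:: 1] [::].
Proof.
(* The one-letter permutation has the sites 0 and 1, before and after its letter. The empty signed
   permutation has -1 and 0, which insert -1 and 1. In both, each site lets the other survive. *)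
exists [:: (0, -1); (1, 0)]; split=> //.
move=> p p'; rewrite !inE => /orP[]/eqP-> /orP[]/eqP->; by [].
Qed.

(** Positivity singles out the permutations among the signed permutations. *)
Definition avoidA s : Prop := all (fun a => 0 < a) s /\ avoid s.
Definition avoidS s : Prop := avoid (sym s).

Lemma extensionA : extension_law actA avoidA.
Proof.
move=> r [k|k] Hr rv; last first.
  split; last by case.
  by case; rewrite all_cat /= => /andP[_]; rewrite /newval.
have [x [y [E sk]]] : exists x y, r = x ++ y /\ k = size x.
  by apply: split_seq; move: rv; rewrite /in_range; lia.
have r'E : child r k = x ++ newval r :: y by have := child_pos x y; rewrite -E sk.
have bel := signed_perm_below Hr.
rewrite (actA_pos E sk) r'E /avoidA avoid_cat_max.
- by rewrite E !all_cat /= /newval /=; split=> [[? []]|[[]]].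
- rewrite -r'E; apply: (@map_uniq _ _ absz).
  exact/signed_perm_uniq/signed_perm_child.
by rewrite -E; apply: sub_all bel => a; lia.
Qed.

Lemma extensionS : extension_law actS avoidS.
Proof.
move=> r v Hr rv; have bel := signed_perm_below Hr.
have U := signed_perm_uniq Hr; have r0 := signed_perm0 Hr.
case: v rv => k rv; have [x [y [E sk]]] : exists x y, r = x ++ y /\ k = size x;
  try by apply: split_seq; move: rv; rewrite /in_range; lia.
  rewrite (actS_pos E sk) /avoidS.
  have -> : child r k = x ++ newval r :: y by have := child_pos x y; rewrite -E sk.
  by rewrite [in sym r]E; apply: avoid_sym_max; rewrite -?E.
rewrite (actS_neg E sk) /avoidS.
have -> : child r (Negz k) = x ++ - newval r :: y.
  by have := child_neg x y; rewrite -E sk.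
by rewrite [in sym r]E; apply: avoid_sym_min; rewrite -?E.
Qed.

Lemma baseA s : s = [:: 1] <-> [/\ signed_perm s, size s = size [:: 1 : int] & avoidA s].
Proof.
split=> [->|[Hs]].
  by split=> //; split=> // a b c d H; have := size_subseq H.
case: s Hs => // a [|//] Hs _ [/andP[a0 _] _].
by have /= H := signed_perm_bound Hs (mem_head _ _); congr cons; lia.
Qed.

Lemma baseS s : s = [::] <-> [/\ signed_perm s, size s = size ([::] : seq int) & avoidS s].
Proof.
split=> [->|[_ /size0nil]//]; split=> // a b c d.
Qed.

Lemma size_levels n : size (level actA [:: 1] n) = size (level actS [::] n).
Proof.
rewrite !size_level; apply: matched_descendants => //.
- exact: step_actA.
- exact: step_actS.
exact: matched_roots.
Qed.

End Levels.

(** * Permutations as words *)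

Section Patterns.

Lemma contains4P N (p0 p1 p2 p3 : nat) (tau : 'S_N) :
  reflect (exists j0 j1 j2 j3 : 'I_N, (j0 < j1 < j2)%N && (j2 < j3)%N /\
     forall a b : 'I_4,
       (tau (nth j0 [:: j0; j1; j2; j3] a) < tau (nth j0 [:: j0; j1; j2; j3] b))%N
       = (nth 0 [:: p0; p1; p2; p3] a < nth 0 [:: p0; p1; p2; p3] b)%N)
    (contains [:: p0; p1; p2; p3] tau).
Proof.
apply: (iffP existsP) => [[j /forallP H]|[j0 [j1 [j2 [j3 [Hj H]]]]]].
  have Hj (a b : 'I_4) : ((a < b)%N ==> (j a < j b)%N) by have /forallP/(_ b)/andP[] := H a.
  exists (j (@Ordinal 4 0 isT)), (j (@Ordinal 4 1 isT)), (j (@Ordinal 4 2 isT)).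
  exists (j (@Ordinal 4 3 isT)); split.
    apply/andP; split; last exact: (implyP (Hj (@Ordinal 4 2 isT) (@Ordinal 4 3 isT)) isT).
    apply/andP; split; first exact: (implyP (Hj (@Ordinal 4 0 isT) (@Ordinal 4 1 isT)) isT).
    exact: (implyP (Hj (@Ordinal 4 1 isT) (@Ordinal 4 2 isT)) isT).
  have jE (a : 'I_4) : nth (j (@Ordinal 4 0 isT)) [:: j (@Ordinal 4 0 isT);
      j (@Ordinal 4 1 isT); j (@Ordinal 4 2 isT); j (@Ordinal 4 3 isT)] a = j a.
    by case: a => [[|[|[|[|]]]] lta] //=; congr (j _); apply: val_inj.
  by move=> a b; rewrite !jE; have /forallP/(_ b)/andP[_ /eqP] := H a.
exists [ffun a : 'I_4 => nth j0 [:: j0; j1; j2; j3] a].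
apply/forallP=> a; apply/forallP=> b; rewrite !ffunE H eqxx andbT.
by case: a => [[|[|[|[|]]]] lta] //; case: b => [[|[|[|[|]]]] ltb] //=; lia.
Qed.

Lemma subseq_map_enum N (f : 'I_N -> int) a b c d :
  subseq [:: a; b; c; d] [seq f i | i <- enum 'I_N] <->
  exists i0 i1 i2 i3 : 'I_N, [/\ (i0 < i1 < i2)%N && (i2 < i3)%N &
    [:: a; b; c; d] = [:: f i0; f i1; f i2; f i3]].
Proof.
have trN : transitive (fun i j : 'I_N => (i < j)%N) by move=> ???; apply: ltn_trans.
have srt : sorted (fun i j : 'I_N => (i < j)%N) (enum 'I_N).
  by have := iota_ltn_sorted 0 N; rewrite -val_enum_ord sorted_map.
split=> [/subseqP[m sm E]|[i0 [i1 [i2 [i3 [lti ->]]]]]].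
  have := sorted_mask trN m srt; rewrite -map_mask in E.
  case: (mask m _) E => [|i0 [|i1 [|i2 [|i3 [|//]]]]] //= E.
  by case/and4P=> l01 l12 l23 _; exists i0, i1, i2, i3; rewrite l01 l12 l23 E.
rewrite -[X in subseq X _]/(map f [:: i0; i1; i2; i3]); apply: map_subseq.
have U : uniq [:: i0; i1; i2; i3] by rewrite /= !inE -!(inj_eq val_inj) /=; lia.
apply/(subseq_uniqP (enum_uniq _))/(@irr_sorted_eq _ (fun i j : 'I_N => (i < j)%N)) => //.
- by move=> i /=; rewrite ltnn.
- by rewrite /=; lia.
- exact: sorted_filter.
by move=> i; rewrite mem_filter mem_enum andbT.
Qed.

Variables (N : nat) (c : 'I_N -> int).
Hypothesis c_mono : {mono c : i j / (i < j)%N >-> i < j}.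
Implicit Types tau : 'S_N.

Lemma c_inj : injective c.
Proof.
move=> i j E; apply: val_inj => /=; have := c_mono i j; have := c_mono j i.
by rewrite E ltxx; lia.
Qed.

(* The value at index i is the position of the value i in tau, so that patterns are
   inverted; c renames positions. *)
Definition word tau : seq int := [seq c ((tau^-1)%g i) | i <- enum 'I_N].

Lemma size_word tau : size (word tau) = N.
Proof. by rewrite size_map size_enum_ord. Qed.

Lemma nth_word tau (i : 'I_N) : nth 0 (word tau) i = c ((tau^-1)%g i).
Proof. by rewrite (nth_map i) ?size_enum_ord // nth_ord_enum. Qed.

Lemma word_inj : injective word.
Proof.
move=> s t E; apply: invg_inj; apply/permP=> i; apply: c_inj.
by rewrite -!nth_word E.
Qed.

Lemma word_uniq tau : uniq (word tau).
Proof. by rewrite map_inj_uniq ?enum_uniq // => i j /c_inj/perm_inj. Qed.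

Lemma word_surj s : size s = N -> uniq s -> (forall a, a \in s -> exists i, a = c i) ->
  exists tau, s = word tau.
Proof.
move=> sN Us sc; have ex (i : 'I_N) : exists j, nth 0 s i == c j.
  by have [|j ->] := sc (nth 0 s i); [rewrite mem_nth ?sN | exists j].
pose f i := xchoose (ex i); have fE i : c (f i) = nth 0 s i.
  by rewrite (eqP (xchooseP (ex i))).
have f_inj : injective f.
  move=> i j /(congr1 c)/eqP; rewrite !fE nth_uniq ?sN // => /eqP.
  exact: val_inj.
exists (perm f_inj)^-1%g; apply: (@eq_from_nth _ 0); first by rewrite size_word.
by move=> i; rewrite sN => lti; rewrite (nth_word _ (Ordinal lti)) invgK permE fE.
Qed.

(** The pattern 4231 is its own inverse, and the inverse of 2413 is 3142. *)
Lemma triangularP tau : triangular tau <-> avoid (word tau).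
Proof.
split=> [/andP[/contains4P H1 /contains4P H2] a b e d|H].
  case/subseq_map_enum=> i0 [i1 [i2 [i3 [lti [-> -> -> ->]]]]].
  rewrite !c_mono; apply/andP; split; apply/negP=> pat.
    case: H1; exists ((tau^-1)%g i3), ((tau^-1)%g i1), ((tau^-1)%g i2), ((tau^-1)%g i0).
    split; first by lia.
    by case=> [[|[|[|[|]]]] lta] // [[|[|[|[|]]]] ltb] //=; rewrite !permKV; lia.
  case: H2; exists ((tau^-1)%g i1), ((tau^-1)%g i3), ((tau^-1)%g i0), ((tau^-1)%g i2).
  split; first by lia.
  by case=> [[|[|[|[|]]]] lta] // [[|[|[|[|]]]] ltb] //=; rewrite !permKV; lia.
apply/andP; split; apply/negP=> /contains4P[j0 [j1 [j2 [j3 [ltj pat]]]]].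
  have l1 := pat (@Ordinal 4 3 isT) (@Ordinal 4 1 isT).
  have l2 := pat (@Ordinal 4 1 isT) (@Ordinal 4 2 isT).
  have l3 := pat (@Ordinal 4 2 isT) (@Ordinal 4 0 isT).
  have := H (c j3) (c j1) (c j2) (c j0); rewrite !c_mono.
  case/(_ _)/andP; last by lia.
  apply/subseq_map_enum; exists (tau j3), (tau j1), (tau j2), (tau j0).
  by split; [move: l1 l2 l3 => /= -> -> -> | rewrite !permK].
have l1 := pat (@Ordinal 4 2 isT) (@Ordinal 4 0 isT).
have l2 := pat (@Ordinal 4 0 isT) (@Ordinal 4 3 isT).
have l3 := pat (@Ordinal 4 3 isT) (@Ordinal 4 1 isT).
have := H (c j2) (c j0) (c j3) (c j1); rewrite !c_mono.
case/(_ _)/andP; last by lia.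
apply/subseq_map_enum; exists (tau j2), (tau j0), (tau j3), (tau j1).
by split; [move: l1 l2 l3 => /= -> -> -> | rewrite !permK].
Qed.

End Patterns.

(** By the pigeonhole principle, distinct absolute values in this range exhaust it. *)
Lemma signed_perm_intro (r : seq int) : uniq (map absz r) ->
  (forall a, a \in r -> 0 < `|a| <= size r) -> signed_perm r.
Proof.
move=> U H; apply: uniq_perm (iota_uniq _ _) _ => //.
apply: (uniq_min_size U _ _).2; last by rewrite size_map size_iota.
by move=> k /mapP[a /H + ->]; rewrite mem_iota; lia.
Qed.

(** * Triangular permutations as a level of the first tree *)

Section CountA.
Variable n : nat.

Definition posA (i : 'I_n.+1) : int := i.+1.

Lemma posA_mono : {mono posA : i j / (i < j)%N >-> i < j}.
Proof. by move=> i j; rewrite /posA ltz_nat. Qed.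

Lemma card_triangular :
  #|[set tau : 'S_n.+1 | triangular tau]| = size (level actA [:: 1] n).
Proof.
rewrite cardE -(size_map (word posA)); apply/perm_size/uniq_perm.
- by rewrite map_inj_uniq ?enum_uniq //; apply: word_inj posA_mono.
- exact: level_uniq extensionA baseA n.
move=> s; apply/mapP/idP => [[tau]|/(mem_level extensionA baseA)[Hs ss [s0 gs]]].
  rewrite mem_enum inE => /(triangularP posA_mono) av ->.
  apply/(mem_level extensionA baseA).
  have mw a : a \in word posA tau -> 0 < a <= n.+1.
    by case/mapP=> i _ ->; rewrite /posA; have := ltn_ord (tau^-1%g i); lia.
  split; rewrite ?size_word //; last first.
    by split=> //; apply/allP=> a /mw/andP[].
  apply: signed_perm_intro => [|a /mw]; last by rewrite size_word; lia.
  rewrite map_inj_in_uniq ?(word_uniq posA_mono) // => a b /mw ? /mw ?; lia.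
have [||a sa|tau sE] := @word_surj _ posA s.
- by rewrite ss add1n.
- exact: (@map_uniq _ _ absz _ (signed_perm_uniq Hs)).
- have a0 := allP s0 _ sa; have := signed_perm_bound Hs sa.
  rewrite ss add1n => ab; have ltn : ((absz a).-1 < n.+1)%N by lia.
  by exists (Ordinal ltn); rewrite /posA /=; lia.
exists tau => //; rewrite mem_enum inE; apply/(triangularP posA_mono).
by rewrite -sE.
Qed.

End CountA.

(** * Triangular permutations commuting with [w_0] as a level of the second tree *)

Section CountS.
Variable n : nat.
Implicit Types (tau : 'S_(2 * n)) (i : 'I_(2 * n)).

Definition symmetric tau : bool := [forall i, tau (rev_ord i) == rev_ord (tau i)].

(* The positions 0, ..., 2n - 1 become -n, ..., -1, 1, ..., n. *)
Definition posS i : int := if (i < n)%N then i%:Z - n%:Z else i%:Z - n%:Z + 1.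

Lemma posS_mono : {mono posS : i j / (i < j)%N >-> i < j}.
Proof. by move=> i j; rewrite /posS; do 2 case: ifP; lia. Qed.

Lemma posS_rev i : posS (rev_ord i) = - posS i.
Proof. by rewrite /posS /=; have := ltn_ord i; do 2 case: ifP; lia. Qed.

Lemma posS_bound i : 0 < `|posS i| <= n.
Proof. by rewrite /posS; have := ltn_ord i; case: ifP; lia. Qed.

Lemma posS_surj (a : int) : 0 < `|a| <= n -> exists i, a = posS i.
Proof.
move=> ab; have [a0|a0] := leP 0 a.
  have lti : ((absz a + n).-1 < 2 * n)%N by lia.
  by exists (Ordinal lti); rewrite /posS /=; case: ifP; lia.
have lti : (n - absz a < 2 * n)%N by lia.
by exists (Ordinal lti); rewrite /posS /=; case: ifP; lia.
Qed.

Local Notation wordS := (word posS).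

(** Reversing the word replaces each value by its image under [rev_ord], and negating the letters
    does the same to positions, by [posS_rev]. *)
Lemma mir_word tau : symmetric tau <-> mir (wordS tau) = wordS tau.
Proof.
have sz : size (mir (wordS tau)) = (2 * n)%N by rewrite size_map size_rev size_word.
have nthm i : nth 0 (mir (wordS tau)) i = - posS (tau^-1%g (rev_ord i)).
  have lti := ltn_ord i; rewrite (nth_map 0) ?size_rev ?size_word // nth_rev ?size_word //.
  by rewrite -nth_word.
split=> [/forallP symt|E].
  have symV i : tau^-1%g (rev_ord i) = rev_ord (tau^-1%g i).
    by apply: (@perm_inj _ tau); rewrite permKV (eqP (symt _)) permKV.
  apply: (@eq_from_nth _ 0); first by rewrite sz size_word.
  move=> k; rewrite sz => ltk; rewrite -[k]/(nat_of_ord (Ordinal ltk)) nthm nth_word.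
  by rewrite symV posS_rev opprK.
apply/forallP=> i; apply/eqP.
have := nthm (tau (rev_ord i)); rewrite E nth_word permK -posS_rev.
move/(c_inj posS_mono)/(can_inj rev_ordK) => iE.
by rewrite [in RHS]iE permKV rev_ordK.
Qed.

Lemma sym_drop s : mir s = s -> size s = (2 * n)%N -> sym (drop n s) = s.
Proof.
move=> ms ss; rewrite /sym -[in RHS](cat_take_drop n s); congr (_ ++ _).
have := ms; rewrite -[in mir s](cat_take_drop n s) mir_cat -[RHS](cat_take_drop n s).
move/eqP; rewrite eqseq_cat => [/andP[/eqP]//|].
by rewrite size_map size_rev size_drop size_takel ss; lia.
Qed.

Definition half tau : seq int := drop n (wordS tau).

Lemma sym_half tau : symmetric tau -> sym (half tau) = wordS tau.
Proof. by move/mir_word=> ms; apply: sym_drop; rewrite ?size_word. Qed.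

Lemma size_half tau : size (half tau) = n.
Proof. by rewrite size_drop size_word; lia. Qed.

Lemma card_symmetric_triangular :
  #|[set tau | symmetric tau & triangular tau]| = size (level actS [::] n).
Proof.
rewrite cardE -(size_map half); apply/perm_size/uniq_perm.
- rewrite map_inj_in_uniq ?enum_uniq // => s t.
  rewrite !mem_enum !inE => /andP[ss _] /andP[st _] E.
  by apply: (word_inj posS_mono); rewrite -sym_half // E sym_half.
- exact: level_uniq extensionS baseS n.
move=> s; apply/mapP/idP => [[tau]|/(mem_level extensionS baseS)[Hs ss gs]].
  rewrite mem_enum inE => /andP[symt /(triangularP posS_mono) av] ->.
  apply/(mem_level extensionS baseS); rewrite /avoidS sym_half // size_half; split=> //.
  have mw a : a \in half tau -> 0 < `|a| <= n.
    by move/mem_drop/mapP=> [i _ ->]; apply: posS_bound.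
  apply: signed_perm_intro => [|a /mw]; last by rewrite size_half.
  have := word_uniq posS_mono tau; rewrite -sym_half // cat_uniq => /and3P[_ /hasPn no U].
  rewrite map_inj_in_uniq // => a b sa sb ab.
  (* If [a = - b], then [a] occurs both in the half word and in its mirror, but the whole word has
     no repetition. *)
  have [//|aE] : a = b \/ a = - b by lia.
  by have := no _ sa; rewrite /= mem_mir aE opprK sb.
rewrite add0n in ss.
have [||a sa|tau sE] := @word_surj _ posS (sym s).
- by rewrite size_cat size_map size_rev ss; lia.
- exact: uniq_sym (signed_perm_uniq Hs) (signed_perm0 Hs).
- apply: posS_surj; move: sa; rewrite mem_cat mem_mir.
  by case/orP=> /(signed_perm_bound Hs); rewrite ss ?normrN.
exists tau; last first.
  by rewrite /half -sE drop_size_cat // size_map size_rev ss.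
rewrite mem_enum inE; apply/andP; split; first by apply/mir_word; rewrite -sE mir_sym.
by apply/(triangularP posS_mono); rewrite -sE.
Qed.

End CountS.

(** * The image of iota *)

Section Weyl.
Variable n : nat.
Implicit Types (w : {perm C_root n}) (tau : 'S_(2 * n)) (i : 'I_n).

(** The pairs acting compatibly on sums of two weights form a group that contains the generators. As
    every root is such a sum, [tau] determines [w]. *)
Lemma iota_graph_sum w tau : (w, tau) \in iota_graph n ->
  forall (k l : 'I_(2 * n)) (r : C_root n), val r = eps k + eps l ->
    val (w r) = eps (tau k) + eps (tau l).
Proof.
pose fits (x : {perm C_root n} * 'S_(2 * n)) := [forall k, forall l, forall r : C_root n,
  (val r == eps k + eps l) ==> (val (x.1 r) == eps (x.2 k) + eps (x.2 l))].
have fitsP (x : {perm C_root n} * 'S_(2 * n)) : reflect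
    (forall k l (r : C_root n), val r = eps k + eps l ->
      val (x.1 r) = eps (x.2 k) + eps (x.2 l)) (fits x).
  apply: (iffP forallP) => [H k l r /eqP rk | H k].
    by have /forallP/(_ l)/forallP/(_ r)/implyP/(_ rk)/eqP := H k.
  by apply/forallP=> l; apply/forallP=> r; apply/implyP=> /eqP/H ->.
have fits_group : group_set [set x | fits x].
  apply/group_setP; split=> [|x y]; rewrite !inE.
    by apply/fitsP=> k l r; rewrite !perm1.
  move=> /fitsP Hx /fitsP Hy; apply/fitsP=> k l r rk.
  by rewrite !permM; apply/Hy/Hx.
suff sub : iota_graph n \subset Group fits_group.
  by move=> /(subsetP sub); rewrite inE => /fitsP.
rewrite gen_subG; apply/subsetP=> _ /imsetP[i _ ->]; rewrite inE.
by apply/fitsP=> k l r rk; rewrite permE /= rk reflD !refl_eps.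
Qed.

Lemma signed_evec_eps (x : 'I_n * bool) :
  exists k : 'I_(2 * n), (-1) ^+ x.2 *: evec n x.1 = eps k.
Proof.
case: x => m b /=; have ltm := ltn_ord m; case: b.
  have ltk : (2 * n - m.+1 < 2 * n)%N by lia.
  exists (Ordinal ltk); rewrite scaleN1r /eps /= ifF; last by lia.
  by congr (- evec _ _); lia.
have ltk : (m < 2 * n)%N by lia.
by exists (Ordinal ltk); rewrite scale1r /eps /= ltm.
Qed.

Lemma root_eps (r : C_root n) : exists k l, val r = eps k + eps l.
Proof.
have := valP r; rewrite mem_filter => /andP[_ /allpairsP[[x y] [_ _ ->]]] /=.
have [k ->] := signed_evec_eps x; have [l ->] := signed_evec_eps y.
by exists k, l.
Qed.

Lemma iota_inj : {in WC n &, injective (@Defs.iota n)}.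
Proof.
move=> u v /iota_graph_ex[tau gu] /iota_graph_ex[tau' gv].
rewrite (iotaP gu) (iotaP gv) => E; apply/permP=> r; apply: val_inj.
have [k [l rE]] := root_eps r.
by rewrite (iota_graph_sum gu rE) (iota_graph_sum gv rE) E.
Qed.

Lemma symmetricP tau :
  reflect (forall k, tau (rev_ord k) = rev_ord (tau k)) (symmetric tau).
Proof. exact: (iffP 'forall_eqP). Qed.

Lemma symmetric_gen i : symmetric (iota_gen i).
Proof.
apply/symmetricP=> k; apply: val_inj; rewrite /= !val_iota_gen /=.
have := ltn_ord i; have := ltn_ord k; case: (ltnP i.+1 n) => ?; do !case: ifP; lia.
Qed.

Lemma symmetricM (s t : 'S_(2 * n)) : symmetric s -> symmetric t -> symmetric (s * t)%g.
Proof.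
by move=> /symmetricP Hs /symmetricP Ht; apply/symmetricP=> k; rewrite !permM Hs Ht.
Qed.

Lemma symmetric_graph w tau : (w, tau) \in iota_graph n -> symmetric tau.
Proof.
have gS : group_set [set x : {perm C_root n} * 'S_(2 * n) | symmetric x.2].
  apply/group_setP; split=> [|x y]; rewrite !inE; last exact: symmetricM.
  by apply/symmetricP=> k; rewrite !perm1.
suff sub : iota_graph n \subset Group gS by move=> /(subsetP sub); rewrite inE.
rewrite gen_subG; apply/subsetP=> _ /imsetP[i _ ->]; rewrite inE /=.
exact: symmetric_gen.
Qed.

Definition weight N (tau : 'S_N) : nat := \sum_(k < N) k * tau k.

Lemma weight_le N (tau : 'S_N) : (weight tau <= \sum_(k < N) k * N)%N.
Proof. by apply: leq_sum => k _; rewrite leq_mul2l ltnW ?orbT. Qed.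

(** The gain is [(y - x) * (tau x - tau y)]. *)
Lemma weight_tperm N (tau : 'S_N) (x y : 'I_N) : (x < y)%N -> (tau y < tau x)%N ->
  (weight tau < weight (tperm x y * tau)%g)%N.
Proof.
move=> xy txy; have yx : y != x by rewrite -(inj_eq val_inj) /=; lia.
rewrite /weight !(bigD1 x (P := predT)) //= !(bigD1 y (P := fun k => k != x)) //=.
rewrite !permM tpermL tpermR.
rewrite [in X in (_ < X)%N](eq_bigr (fun k : 'I_N => k * tau k)%N); last first.
  by move=> k /andP[kx ky]; rewrite permM tpermD // eq_sym.
rewrite !addnA ltn_add2r; nia.
Qed.

Lemma weight_transp N (tau : 'S_N) (k : nat) (x y : 'I_N) : (0 < k)%N ->
  x = k.-1 :> nat -> y = k :> nat -> (tau y < tau x)%N ->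
  (weight tau < weight (transp N k * tau)%g)%N.
Proof.
move=> k0 xk yk txy; rewrite /transp -xk -yk !valK; apply: weight_tperm => //.
by rewrite xk yk; lia.
Qed.

Lemma simple_refl2 i : (simple_refl i * simple_refl i = 1)%g.
Proof. by apply/permP=> r; rewrite permM perm1 !permE; apply: val_inj; apply: reflK. Qed.

Lemma iota_gen2 i : (iota_gen i * iota_gen i = 1)%g.
Proof.
have si : simple_refl i \in WC n by apply/mem_gen/imset_f.
by rewrite -iota_s -iotaM // simple_refl2 (morph1 (iota_morphism n)).
Qed.

Lemma symmetric_increasing tau : symmetric tau ->
  (forall x y : 'I_(2 * n), y = x.+1 :> nat -> (x < n)%N -> (tau x < tau y)%N) ->
  tau = 1%g.
Proof.
move=> /symmetricP symt inc.
have inc' (x y : 'I_(2 * n)) : y = x.+1 :> nat -> (tau x < tau y)%N.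
  move=> xy; have [xn|nx] := ltnP x n; first exact: inc.
  have := inc (rev_ord y) (rev_ord x); rewrite !symt /=.
  by have := ltn_ord (tau x); have := ltn_ord (tau y); have := ltn_ord y; lia.
have ge (k : 'I_(2 * n)) : (k <= tau k)%N.
  case: k => k; elim: k => // k IH ltk.
  have ltk' : (k < 2 * n)%N by lia.
  have := IH ltk'; have := inc' (Ordinal ltk') (Ordinal ltk) erefl; rewrite /=; lia.
apply/permP=> k; rewrite perm1; apply: val_inj => /=; have := ge k.
by have := ge (rev_ord k); rewrite symt /=; have := ltn_ord k; have := ltn_ord (tau k); lia.
Qed.

Lemma iota_onto tau : symmetric tau -> exists2 w, w \in WC n & Defs.iota w = tau.
Proof.
(* Induction on the gap between the weight and the upper bound of [weight_le]. *)
have [m] := ubnP (\sum_(k < 2 * n) k * (2 * n) - weight tau).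
elim: m tau => // m IH tau ltm symt.
have [->|nt1] := eqVneq tau 1%g.
  by exists 1%g; rewrite ?group1 ?(morph1 (iota_morphism n)).
have [i lt_wt] : exists i, (weight tau < weight (iota_gen i * tau)%g)%N.
  apply/existsP; apply: contraNT nt1; rewrite negb_exists => /forallP noinc.
  apply/eqP/symmetric_increasing => // x y yx xn.
  have := noinc (Ordinal xn); rewrite -leqNgt; apply: contraTT; rewrite -leqNgt -ltnNge.
  have txy : tau x != tau y by rewrite (inj_eq perm_inj) -(inj_eq val_inj) /=; lia.
  rewrite leq_eqVlt eq_sym (inj_eq val_inj) (negPf txy) /= => ltyx.
  have lty := ltn_ord y; rewrite /iota_gen /=; case: ifP => x1n; last first.
    by apply: (@weight_transp _ _ _ x y); rewrite ?yx //=; lia.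
  have ltu : (2 * n - x.+2 < 2 * n)%N by lia.
  have ltv : (2 * n - x.+1 < 2 * n)%N by lia.
  (* By symmetry the descent at [x], [y] has a mirror descent, so both transpositions in [iota_gen]
     increase the weight. *)
  have ltuv : (tau (Ordinal ltv) < tau (Ordinal ltu))%N.
    have -> : Ordinal ltv = rev_ord x by apply: val_inj.
    have -> : Ordinal ltu = rev_ord y by apply: val_inj => /=; rewrite yx.
    move/symmetricP: symt => symt; rewrite !symt /=.
    by have := ltn_ord (tau x); have := ltn_ord (tau y); lia.
  rewrite -mulgA; apply: (@ltn_trans (weight (transp (2 * n) (2 * n - x.+1) * tau)%g)).
    by apply: (@weight_transp _ _ _ (Ordinal ltu) (Ordinal ltv)) => //=; lia.
  apply: (@weight_transp _ _ _ x y) => //.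
  (* The second transposition moves only places beyond [x.+1], as [x.+1 < n], so the descent at [x],
     [y] is still there after it. *)
  have fix_ (z : 'I_(2 * n)) : (z <= x.+1)%N -> transp (2 * n) (2 * n - x.+1) z = z.
    move=> zx; apply: val_inj; rewrite /= val_transp; last by lia.
    by do 2 (case: eqP => ?; first by lia).
  by rewrite !permM !fix_ // yx.
have [||w wW Ew] := IH (iota_gen i * tau)%g.
- by have := weight_le (iota_gen i * tau)%g; lia.
- by apply: symmetricM => //; apply: symmetric_gen.
have si : simple_refl i \in WC n by apply/mem_gen/imset_f.
exists (simple_refl i * w)%g; first exact: groupM.
by rewrite iotaM // iota_s Ew mulgA iota_gen2 mul1g.
Qed.

Lemma card_symplectic_triangular :
  #|[set w in WC n | symplectic_triangular w]|
  = #|[set tau : 'S_(2 * n) | symmetric tau & triangular tau]|.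
Proof.
rewrite -(card_in_imset (f := @Defs.iota n)); last first.
  by move=> u v /setIdP[uW _] /setIdP[vW _]; apply: iota_inj.
apply: eq_card => tau; rewrite inE; apply/imsetP/andP => [[w /setIdP[wW tw] ->]|[st tt]].
  split=> //; have [s gs] := iota_graph_ex wW.
  by rewrite (iotaP gs); apply: symmetric_graph gs.
have [w wW Ew] := iota_onto st; exists w => //.
by apply/setIdP; rewrite /symplectic_triangular Ew.
Qed.

End Weyl.

Theorem corollary4p6 (n : nat) (n_ge1 : (1 <= n)%N) :
  #|[set w in WC n | symplectic_triangular w]|
  = #|[set tau : 'S_n.+1 | triangular tau]|.
Proof.
by rewrite card_symplectic_triangular card_symmetric_triangular card_triangular size_levels.
Qed.
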